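(* Let $G$ be a finite simple connected graph which is complete intersection and which has exactly two non-bipartite blocks $B_1,B_2$. Let $y_{1,2}$ be the cut vertex of $B_1$ lying on the unique path from $B_1$ to $B_2$ in the block tree of $G$, and $y_{2,1}$ the cut vertex of $B_2$ lying on that path. Then: each of $B_1,B_2$ contains at most two odd chordless cycles; $B_1$ contains exactly one odd chordless cycle passing through $y_{1,2}$, and $B_2$ contains exactly one odd chordless cycle passing through $y_{2,1}$; and if $B_1$ (resp. $B_2$) contains another odd chordless cycle, then this cycle has distance one from $y_{1,2}$ (resp. $y_{2,1}$), i.e. it does not contain that vertex but contains a vertex adjacent to it.
   Context: For a finite simple graph $G$ with edges $e_1,\dots,e_m$ and a field $K$, the toric ideal $I_G\subseteq K[e_1,\dots,e_m]$ is the kernel of the $K$-algebra map $e_i=\{v_j,v_k\}\mapsto v_jv_k$; $G$ is complete intersection if $I_G$ is generated by $\operatorname{ht}(I_G)$ elements. A block is a maximal biconnected subgraph of $G$. The block tree of $G$ is the bipartite graph whose vertices are the blocks and the cut vertices of $G$, with a block $B$ adjacent to a cut vertex $v$ iff $v\in B$. A cycle is chordless if no edge of $G$ joins two of its vertices other than its own edges. *)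

(* Defs.v *)
From HB Require Import structures.
From mathcomp Require Import all_boot all_order all_algebra.
Unset Printing Implicit Defensive.
Import GRing.Theory.
Local Open Scope ring_scope.

(* mpoly K n = K[x_0,...,x_{n-1}], x_{n-1} being the outermost variable. *)
Fixpoint mpoly (K : fieldType) (n : nat) : comNzRingType :=
  if n is n'.+1 then ({poly mpoly K n'} : comNzRingType) else K.

Fixpoint mconst (K : fieldType) (n : nat) : K -> mpoly K n :=
  match n return K -> mpoly K n with
  | 0 => fun c => c
  | n'.+1 => fun c => (mconst K n' c)%:P
  end.

(* the variable x_i (i < n); 0 if i >= n *)
Fixpoint mvar (K : fieldType) (n : nat) (i : nat) : mpoly K n :=
  match n return mpoly K n with
  | 0 => 0
  | n'.+1 => if i == n' then 'X else (mvar K n' i)%:P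
  end.

Fixpoint meval (K : fieldType) (S : comNzRingType) (f : K -> S) (a : nat -> S)
  (n : nat) : mpoly K n -> S :=
  match n return mpoly K n -> S with
  | 0 => f
  | n'.+1 => fun p => (map_poly (meval K S f a n') p).[a n']
  end.

Set Implicit Arguments. Unset Strict Implicit.

Section Ideals.
Variable R : comNzRingType.

Definition is_ideal (I : R -> Prop) : Prop :=
  [/\ I 0, (forall x y, I x -> I y -> I (x + y)) & (forall r x, I x -> I (r * x))].

Definition is_prime_ideal (P : R -> Prop) : Prop :=
  [/\ is_ideal P, ~ P 1 & (forall x y, P (x * y) -> P x \/ P y)].

Definition ideal_sub (I J : R -> Prop) : Prop := forall x, I x -> J x.

Definition ideal_ssub (I J : R -> Prop) : Prop :=
  ideal_sub I J /\ exists x, J x /\ ~ I x.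

Definition generated_by (I : R -> Prop) (g : seq R) : Prop :=
  forall x, I x <-> exists c : nat -> R, x = \sum_(i < size g) c i * g`_i.

Definition prime_chain_to (P : R -> Prop) (h : nat) : Prop :=
  exists Q : nat -> (R -> Prop),
    [/\ forall i, i <= h -> is_prime_ideal (Q i),
        forall i, i < h -> ideal_ssub (Q i) (Q i.+1)
      & forall x, Q h x <-> P x]%N.

Definition prime_height (P : R -> Prop) (h : nat) : Prop :=
  prime_chain_to P h /\ ~ prime_chain_to P h.+1.

Definition ideal_height (I : R -> Prop) (h : nat) : Prop :=
  (exists P, [/\ is_prime_ideal P, ideal_sub I P & prime_height P h]) /\
  (forall P k, is_prime_ideal P -> ideal_sub I P -> prime_height P k -> (h <= k)%N).

Definition complete_intersection (I : R -> Prop) : Prop :=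
  exists g : seq R, generated_by I g /\ ideal_height I (size g).
End Ideals.

(* Finite simple graphs: a symmetric irreflexive relation e on T.      *)
Section Graphs.
Variable T : finType.
Variable e : rel T.

Definition gedges : {set {set T}} :=
  [set E | [exists x, exists y, e x y && (E == [set x; y])]].

(* toric ideal of the graph: kernel of K[e_1..e_m] -> K[v_1..v_n],
   e_i = {v_j,v_k} |-> v_j v_k *)
Definition edge_image (K : fieldType) (i : nat) : mpoly K #|T| :=
  if insub i is Some j then
    \prod_(v in @enum_val _ (mem gedges) j) mvar K #|T| (enum_rank v)
  else 0.

Definition toric_map (K : fieldType) : mpoly K #|gedges| -> mpoly K #|T| :=
  meval K _ (mconst K #|T|) (@edge_image K) #|gedges|.

Definition toric_ideal (K : fieldType) : mpoly K #|gedges| -> Prop :=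
  fun p => toric_map p = 0.

Definition graph_CI (K : fieldType) : Prop :=
  complete_intersection (@toric_ideal K).

Definition induced (S : {set T}) : rel T :=
  [rel x y | [&& x \in S, y \in S & e x y]].

Definition connected_in (S : {set T}) : bool :=
  [forall x in S, forall y in S, connect (induced S) x y].

Definition gconnected : bool := connected_in [set: T].

Definition biconnected (S : {set T}) : bool :=
  [&& (1 < #|S|)%N, connected_in S & [forall v in S, connected_in (S :\ v)]].

Definition is_block (B : {set T}) : bool :=
  biconnected B && [forall S : {set T}, (B \proper S) ==> ~~ biconnected S].

Definition is_cut (v : T) : bool := ~~ connected_in ([set: T] :\ v).

Definition bipartite_in (S : {set T}) : Prop :=
  exists f : T -> bool, forall x y, x \in S -> y \in S -> e x y -> f x != f y.

Definition btree_adj : rel ({set T} + T) :=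
  fun a b => match a, b with
  | inl B, inr v => [&& is_block B, is_cut v & v \in B]
  | inr v, inl B => [&& is_block B, is_cut v & v \in B]
  | _, _ => false
  end.

(* chordless cycles, identified with their vertex set *)
Definition chordless_cycle_seq (s : seq T) : bool :=
  [&& uniq s, (2 < size s)%N, cycle e s &
      all (fun x => all (fun y => e x y ==> ((y == next s x) || (x == next s y))) s) s].

Definition odd_chordless_cycle (C : {set T}) : Prop :=
  exists s : seq T, [/\ chordless_cycle_seq s, odd (size s) & C = [set x in s]].
End Graphs.

(* Main.v *)
Require Import Defs.
From HB Require Import structures.
From mathcomp Require Import all_boot all_order all_algebra.
From mathcomp Require Import boolp zify ring.
From mathcomp Require mpoly.
Set Implicit Arguments. Unset Strict Implicit. Unset Printing Implicit Defensive.
Import Order.TTheory GRing.Theory Num.Theory.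

(* If I_G is a complete intersection, then it has a binomial generating set U
   whose exponent vectors are linearly independent: the classes of the minimal
   binomials are independent in I_G / m I_G, so there are at most
   ht I_G <= #edges - rank of them (the height bound is a transcendence degree
   count along a chain of primes), while they span the lattice of relations.
   Moreover two monomials of the same degree b differ by a combination of
   elements of U of degree <= b.

   Let y = y12 and let H be the side of y containing B1.  By independence,
   exactly one element of U is unbalanced at y when restricted to H, and its
   degree is below the degree of every binomial with this property.  Two odd
   closed walks based at y, one on each side, give such a binomial.  Since B1 is
   biconnected, an odd cycle C of B1 can be reached from y avoiding any given
   vertex; hence the straddling element has degree at most 1 on C, at most 2 at
   y, and 0 elsewhere in H.  If y is not on C then y has two neighbours on C,
   and if y is on C and C is chordless then C is exactly the support.  Applied
   to a shortest odd cycle this gives the odd chordless cycle through y.  Two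
   odd chordless cycles C, C' avoiding y give relations on C + y and on C' + y
   whose difference is a nonzero relation on the union of C and C'; independence
   of U forces it to come from relations on C or on C', of which there are
   none. *)

Module ToricAlgebra.
(* [Defs] is imported again because [mpoly] shadows the type it defines. *)
Import mpoly Defs.
Local Open Scope ring_scope.

(** * Evaluation of iterated polynomials, and comparison with [{mpoly K[n]}] *)

Section Meval.
Variables (K : fieldType) (S : comNzRingType) (f : {rmorphism K -> S}).
Variable a : nat -> S.

Lemma meval_is_morphism n :
  zmod_morphism (meval K S f a n) /\ monoid_morphism (meval K S f a n).
Proof.
elim: n => [|n [IHa IHm]]; first by split; [exact: raddfB | exact: rmorphism_monoidP].
pose A := GRing.isZmodMorphism.Build _ _ (meval K S f a n) IHa.
pose M := GRing.isMonoidMorphism.Build _ _ (meval K S f a n) IHm.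
pose g : {rmorphism mpoly K n -> S} := HB.pack (meval K S f a n) A M.
have E (p : mpoly K n.+1) : meval K S f a n.+1 p = (map_poly g p).[a n] by [].
split=> [p q|]; first by rewrite !E rmorphB hornerD hornerN.
by split=> [|p q]; rewrite !E ?rmorph1 ?hornerC ?rmorphM ?hornerM.
Qed.

HB.instance Definition _ n :=
  GRing.isZmodMorphism.Build _ _ (meval K S f a n) (meval_is_morphism n).1.
HB.instance Definition _ n :=
  GRing.isMonoidMorphism.Build _ _ (meval K S f a n) (meval_is_morphism n).2.

Lemma mevalS n (p : mpoly K n.+1) :
  meval K S f a n.+1 p = (map_poly (meval K S f a n) p).[a n].
Proof. by []. Qed.

Lemma meval_MXaddC n (p : {poly mpoly K n}) c :
  meval K S f a n.+1 (p * 'X + c%:P) =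
  meval K S f a n.+1 p * a n + meval K S f a n c.
Proof.
by rewrite !mevalS rmorphD rmorphM /= map_polyX map_polyC hornerMXaddC.
Qed.

Lemma meval_const n c : meval K S f a n (mconst K n c) = f c.
Proof. by elim: n => //= n IH; rewrite map_polyC hornerC. Qed.

Lemma meval_var n i : (i < n)%N -> meval K S f a n (mvar K n i) = a i.
Proof.
elim: n => //= n IH; rewrite ltnS leq_eqVlt; case: eqVneq => [->|_ /= ltin].
  by rewrite map_polyX hornerX.
by rewrite map_polyC hornerC; exact: IH.
Qed.

End Meval.

Lemma eq_meval (K : fieldType) (S : comNzRingType) (f g : {rmorphism K -> S})
    (a b : nat -> S) n :
  f =1 g -> (forall i, (i < n)%N -> a i = b i) ->
  meval K S f a n =1 meval K S g b n.
Proof.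
move=> fg; elim: n => //= n IH ab p; rewrite ab //.
by congr (_.[_]); apply: eq_map_poly => q; apply: IH => i lin; apply/ab/ltnW.
Qed.

Lemma meval_comp (K : fieldType) (S S' : comNzRingType) (f : {rmorphism K -> S})
    (h : {rmorphism S -> S'}) a n p :
  h (meval K S f a n p) = meval K S' (h \o f) (h \o a) n p.
Proof.
elim: n p => //= n IH p.
by rewrite -horner_map -map_poly_comp /=; congr (_.[_]); apply: eq_map_poly.
Qed.

Lemma mconst_is_morphism K n :
  zmod_morphism (mconst K n) /\ monoid_morphism (mconst K n).
Proof.
elim: n => [|n [IHa [IH1 IHm]]]; first by split.
split=> [p q|]; first by rewrite /= IHa polyCB.
by split=> [|p q]; rewrite /= ?IH1 ?IHm ?polyCM.
Qed.
HB.instance Definition _ K n :=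
  GRing.isZmodMorphism.Build _ _ (mconst K n) (mconst_is_morphism K n).1.
HB.instance Definition _ K n :=
  GRing.isMonoidMorphism.Build _ _ (mconst K n) (mconst_is_morphism K n).2.

Lemma meval_id (K : fieldType) n :
  meval K _ (mconst K n) (mvar K n) n =1 id.
Proof.
elim: n => // n IH p; rewrite mevalS.
rewrite (_ : mvar K n.+1 n = 'X); last by rewrite /= eqxx.
have -> : map_poly (meval K (mpoly K n.+1) (mconst K n.+1) (mvar K n.+1) n) p
   = map_poly (polyC \o id) p.
  apply: eq_map_poly => q /=; rewrite -{2}[q]IH.
  rewrite (meval_comp _ (polyC : {rmorphism mpoly K n -> {poly mpoly K n}})).
  apply: (eq_meval (f := mconst K n.+1) (g := polyC \o mconst K n)) => // i lin /=.
  by rewrite ltn_eqF.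
by rewrite map_poly_comp map_poly_id // -[RHS]comp_polyXr.
Qed.

(** Extension by zero, since [meval] takes its values from a function on [nat]. *)
Definition ordfun (n : nat) (S : nmodType) (a : 'I_n -> S) (i : nat) : S :=
  if insub i is Some j then a j else 0.

Lemma ordfunE n (S : nmodType) (a : 'I_n -> S) (i : 'I_n) : ordfun a i = a i.
Proof. by rewrite /ordfun valK. Qed.

Definition to_mp (K : fieldType) n : mpoly K n -> {mpoly K[n]} :=
  meval K _ (mpolyC n (R := K)) (ordfun (fun i : 'I_n => 'X_i)) n.

Definition of_mp (K : fieldType) n : {mpoly K[n]} -> mpoly K n :=
  mmap (mconst K n) (fun i : 'I_n => mvar K n i).

HB.instance Definition _ K n := GRing.RMorphism.on (@to_mp K n).
HB.instance Definition _ K n := GRing.RMorphism.on (@of_mp K n).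

Lemma mmap_to_mp (K : fieldType) n (S : comNzRingType) (f : {rmorphism K -> S})
    (a : 'I_n -> S) p :
  mmap f a (to_mp p) = meval K S f (ordfun a) n p.
Proof.
rewrite (meval_comp _ (mmap f a)); apply: eq_meval => [c|i lin] /=.
  exact: mmapC.
by rewrite -[i]/(val (Ordinal lin)) !ordfunE mmapX mmap1U.
Qed.

Lemma to_mpK K n : cancel (@to_mp K n) (@of_mp K n).
Proof.
move=> p; rewrite /of_mp mmap_to_mp -[RHS]meval_id; apply: eq_meval => // i lin.
by rewrite -[i]/(val (Ordinal lin)) ordfunE.
Qed.

Lemma of_mpK K n : cancel (@of_mp K n) (@to_mp K n).
Proof.
move=> p; rewrite [p in RHS]mpolyE /of_mp /mmap rmorph_sum; apply: eq_bigr => a _.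
rewrite rmorphM /= {1}/to_mp meval_const mul_mpolyC; congr (_ *: _).
rewrite mpolyXE_id rmorph_prod; apply: eq_bigr => i _.
by rewrite rmorphXn /= /to_mp meval_var // ordfunE.
Qed.

Lemma to_mp_inj K n : injective (@to_mp K n).
Proof. exact: can_inj (@to_mpK K n). Qed.

(** * Algebraic dependence and the bound on heights *)

Lemma msize_prod_expr (K : fieldType) N m D (a : 'I_N -> {mpoly K[m]})
    (r : seq 'I_N) (s : 'I_N -> nat) t :
  (forall i, (msize (a i) <= D.+1)%N) -> (forall i, (s i <= t)%N) ->
  (msize (\prod_(i <- r) a i ^+ s i) <= (size r * (t * D)).+1)%N.
Proof.
move=> aD st.
have X1 (p q : {mpoly K[m]}) u v :
    (msize p <= u.+1 -> msize q <= v.+1 -> msize (p * q) <= (u + v).+1)%N.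
  move=> pu qv; have [->|p0] := eqVneq p 0; first by rewrite mul0r msize0.
  have [->|q0] := eqVneq q 0; first by rewrite mulr0 msize0.
  rewrite msizeM //.
  by move: pu qv; move: (mmeasure _ p) (mmeasure _ q) => x y; lia.
have X2 (i : 'I_N) k : (msize (a i ^+ k) <= (k * D).+1)%N.
  elim: k => [|k IH]; first by rewrite expr0 msize1.
  by rewrite exprS mulSn; apply: X1.
elim: r => [|i r IH]; first by rewrite big_nil msize1.
rewrite big_cons /= mulSn; apply: X1 => //.
by apply: leq_trans (X2 _ _) _; rewrite ltnS leq_mul2r st orbT.
Qed.

(** Counting: there are more products of the [a i] with exponents at most [t] than monomials of the
    target with exponents below [k], and the products are supported on the latter, so they satisfy a
    linear relation. *)
Lemma alg_dependent (K : fieldType) m (a : 'I_m.+1 -> {mpoly K[m]}) :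
  exists2 F : {mpoly K[m.+1]}, F != 0 & mmap (mpolyC m (R := K)) a F = 0.
Proof.
pose D := (\max_i msize (a i))%N.
have aD i : (msize (a i) <= D.+1)%N by apply: leqW; apply: (leq_bigmax i).
(* With [c = m.+1 * D + 1] and [t = c ^ m] one has [k <= c * t], so
   [k ^ m <= t ^ m.+1 < t.+1 ^ m.+1]. *)
pose t := ((m.+1 * D + 1) ^ m)%N.
pose k := (m.+1 * (t * D)).+1%N.
pose I := {ffun 'I_m.+1 -> 'I_t.+1}; pose J := {ffun 'I_m -> 'I_k}.
pose mI (s : I) : 'X_{1..m.+1} := [multinom (s i : nat) | i < m.+1].
pose mJ (s : J) : 'X_{1..m} := [multinom (s i : nat) | i < m].
pose M : 'M[K]_(#|I|, #|J|) :=
  \matrix_(s, c) (mmap1 a (mI (enum_val s)))@_(mJ (enum_val c)).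
have ltJI : (#|J| < #|I|)%N.
  rewrite /I /J !card_ffun !card_ord.
  have leX x y : (x <= y -> x ^ m <= y ^ m)%N.
    by case: (m) => // m' le; rewrite leq_exp2r.
  have t0 : (0 < t)%N by rewrite expn_gt0 addn1.
  have le1 : (k <= (m.+1 * D + 1) * t)%N by rewrite /k; nia.
  apply: (@leq_ltn_trans (((m.+1 * D + 1) * t) ^ m)); first exact: leX.
  rewrite expnMn -/t expnS; apply: leq_trans (_ : (t.+1 * t ^ m <= _)%N).
    by rewrite ltn_pmul2r // expn_gt0 t0.
  by rewrite leq_mul2l leX ?orbT.
(* A left kernel vector of [M] is the coefficient vector of [F]. *)
have : (kermx M != 0).
  rewrite kermx_eq0; apply/negP => /eqP rM.
  by move: (rank_leq_col M); rewrite rM leqNgt ltJI.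
case/rowV0Pn => w /sub_kermxP wM w0.
pose F : {mpoly K[m.+1]} := \sum_s w 0 s *: 'X_[mI (enum_val s)].
have mI_inj : injective (mI \o enum_val : 'I_#|I| -> _).
  move=> s s' /mnmP E; apply: enum_val_inj; apply/ffunP => i; apply: val_inj.
  by move: (E i); rewrite !mnmE.
have FE s : F@_(mI (enum_val s)) = w 0 s.
  rewrite /F raddf_sum /= (bigD1 s) //= mcoeffZ mcoeffX eqxx mulr1 big1 ?addr0 //.
  move=> s' s's; rewrite mcoeffZ mcoeffX.
  have -> // : (mI (enum_val s') == mI (enum_val s)) = false.
    by apply: contraNF s's => /eqP /mI_inj ->.
  by rewrite mulr0.
exists F.
  apply: contraNneq w0 => F0; apply/eqP/rowP => s; by rewrite -FE F0 mcoeff0 mxE.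
have -> : mmap (mpolyC m (R := K)) a F = \sum_s w 0 s *: mmap1 a (mI (enum_val s)).
  rewrite /F raddf_sum /=; apply: eq_bigr => s _.
  by rewrite mmapZ mmapX mul_mpolyC.
apply/mpolyP => c; rewrite mcoeff0 raddf_sum /=.
(* Exponents below [k] are columns of [M]; the other coefficients vanish because the degree is too
   large. *)
have [ck|ck] := boolP [forall i, c i < k]%N.
  pose c' : J := [ffun i => Ordinal (forallP ck i)].
  have mc : mJ c' = c by apply/mnmP => i; rewrite mnmE ffunE.
  move/rowP: wM => /(_ (enum_rank c')); rewrite !mxE => E; rewrite -[RHS]E.
  apply: eq_bigr => s _; by rewrite mcoeffZ mxE enum_rankK mc.
apply: big1 => s _; rewrite mcoeffZ.
rewrite (memN_msupp_eq0 (m := c)) ?mulr0 //; apply: msize_mdeg_ge.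
rewrite /mmap1; apply: leq_trans (_ : k <= _)%N.
  have := msize_prod_expr (index_enum 'I_m.+1) (t := t)
     (s := fun i => mI (enum_val s) i) aD.
  have -> : size (index_enum 'I_m.+1) = m.+1.
    by rewrite -[RHS](size_enum_ord m.+1) enumT /index_enum; unlock.
  by apply=> i; rewrite mnmE -ltnS.
case/forallPn: ck => i; rewrite -leqNgt => /leq_trans; apply.
by rewrite mdegE (bigD1 i) //= leq_addr.
Qed.

Definition alg_indep_mod (K : fieldType) m (P : mpoly K m -> Prop) N
    (a : nat -> mpoly K m) :=
  forall F : mpoly K N, P (meval K _ (mconst K m) a N F) -> F = 0.

Lemma alg_indep_mod_le (K : fieldType) m (P : mpoly K m -> Prop) N N' a :
  (N' <= N)%N -> alg_indep_mod P N a -> alg_indep_mod P N' a.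
Proof.
elim: N => [|N IH]; first by rewrite leqn0 => /eqP->.
rewrite leq_eqVlt => /predU1P[-> //|lt] H; apply: IH => // F PF.
by apply: polyC_inj; apply: H; rewrite mevalS map_polyC hornerC.
Qed.

Lemma alg_indep_leq (K : fieldType) m (P : mpoly K m -> Prop) N a :
  P 0 -> alg_indep_mod P N a -> (N <= m)%N.
Proof.
move=> P0 H; rewrite leqNgt; apply/negP => lt; have {lt}H := alg_indep_mod_le lt H.
have [F F0 EF] := alg_dependent (fun i : 'I_m.+1 => to_mp (a i)).
case/eqP: F0; rewrite -[F]of_mpK (H (of_mp F)) ?raddf0 //.
suff -> : meval K (mpoly K m) (mconst K m) a m.+1 (of_mp F) = 0 by [].
apply: to_mp_inj; rewrite raddf0 -EF -{2}[F]of_mpK mmap_to_mp meval_comp.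
apply: (eq_meval (f := @to_mp K m \o mconst K m) (g := mpolyC m (R := K))).
  by move=> c /=; rewrite /to_mp meval_const.
by move=> i lin; rewrite -[i]/(val (Ordinal lin)) ordfunE.
Qed.

(** Substitute [x] for the new outermost variable. Modulo [Q] only the constant coefficient
    survives, so it is zero by independence; then [x] divides the value, and primality of [P]
    removes that factor and lowers the degree. *)
Lemma alg_indep_mod_extend (K : fieldType) m (P Q : mpoly K m -> Prop) N a x :
  is_prime_ideal P -> is_ideal Q -> ideal_sub P Q -> Q x -> ~ P x ->
  alg_indep_mod Q N a ->
  alg_indep_mod P N.+1 (fun i => if i == N then x else a i).
Proof.
move=> [_ _ Pp] [_ QD QM] PQ Qx Px HQ F.
set b := fun i => _; have bN : b N = x by rewrite /b eqxx.
have eqb q : meval K _ (mconst K m) b N q = meval K _ (mconst K m) a N q.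
  by apply: eq_meval => // i lin; rewrite /b ltn_eqF.
elim/poly_ind: F => [//|F c IH].
rewrite meval_MXaddC bN => PFc.
have c0 : c = 0.
  apply: HQ; rewrite -eqb /=.
  move: (PQ _ PFc); set u := (_ * x); set v := meval _ _ _ _ _ c => Quv.
  have -> : v = (u + v) + (-1) * u by rewrite mulN1r addrAC subrr add0r.
  by apply: (QD) => //; apply/QM; rewrite /u; apply: QM.
move: PFc; rewrite c0 !raddf0 !addr0 => /Pp[/IH->|//]; by rewrite mul0r.
Qed.

(** Descend the chain from [P]: each strict inclusion supplies one more independent element, and
    [d + h] elements independent modulo the bottom prime cannot exceed [m]. *)
Lemma prime_chain_bound (K : fieldType) m (P : mpoly K m -> Prop) h d a :
  prime_chain_to P h -> alg_indep_mod P d a -> (d + h <= m)%N.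
Proof.
case=> Q [Qp Qs QP] ai.
suff /(_ h (leqnn h))[b] : forall j, (j <= h)%N ->
    exists b, alg_indep_mod (Q (h - j)%N) (d + j) b.
  by apply: alg_indep_leq; rewrite subnn; case: (Qp 0 (leq0n _)) => -[].
elim=> [_|j IH lj]; first by exists a; rewrite subn0 addn0 => F /QP; apply: ai.
have [b ab] := IH (ltnW lj).
have E : (h - j)%N = (h - j.+1).+1 by lia.
have lt : (h - j.+1 < h)%N by lia.
have [sub [x [Qx nQx]]] := Qs _ lt.
rewrite addnS; exists (fun i => if i == (d + j)%N then x else b i).
apply: alg_indep_mod_extend sub _ nQx _; rewrite -?E //.
- by apply: Qp; apply: leq_subr.
- by case: (Qp (h - j)%N (leq_subr _ _)).
- by rewrite E.
Qed.

(** [prime_height] is a relation, so a height of [P] must first be found: chain lengths are bounded,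
    hence a longest one exists. It bounds [h] because [P] contains itself. *)
Lemma ideal_height_le (K : fieldType) m (P : mpoly K m -> Prop) h d a :
  is_prime_ideal P -> ideal_height P h -> alg_indep_mod P d a -> (d + h <= m)%N.
Proof.
move=> Pp [_ Hmin] ai.
have c0 : prime_chain_to P 0 by exists (fun=> P); split.
have [k Pk] : exists k, prime_height P k.
  apply: contrapT => no.
  suff /(_ m.+1) : forall j, prime_chain_to P j.
    by move=> /prime_chain_bound /(_ ai); lia.
  elim=> [//|j IH]; apply: contrapT => nj; apply: no; by exists j.
have lhk : (h <= k)%N by apply: Hmin Pk.
by have := prime_chain_bound Pk.1 ai; lia.
Qed.

Lemma bounded_finite (X : eqType) (P : X -> Prop) h :
  (forall s : seq X, uniq s -> (forall x, x \in s -> P x) -> (size s <= h)%N) ->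
  exists s : seq X, uniq s /\ forall x, x \in s <-> P x.
Proof.
move=> Hs; apply: contrapT => no.
suff [s [us Ps ss]] : exists s : seq X,
    [/\ uniq s, forall x, x \in s -> P x & size s = h.+1].
  by have := Hs s us Ps; rewrite ss ltnn.
elim: h.+1 => [|k [s [us Ps ss]]]; first by exists [::].
have [x Px xs] : exists2 x, P x & x \notin s.
  apply: contrapT => nx; apply: no; exists s; split=> // x; split; first exact: Ps.
  by move=> Px; apply: contrapT => /negP xs; apply: nx; exists x.
exists (x :: s); split => /=; rewrite ?xs ?us ?ss // => z.
by rewrite inE => /predU1P[->//|/Ps].
Qed.

(** * Binomials of a toric ideal, graded by their image monomials *)

Section Toric.
Variables (K : fieldType) (m n : nat) (D : 'I_m -> 'X_{1..n}).
Implicit Types a b c x : 'X_{1..m}.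

(** Exponent vector of the image of the monomial [a], that is its multidegree. *)
Definition dg a : 'X_{1..n} := (\sum_i D i *+ a i)%MM.

Hypothesis dg_mdeg : forall a b, dg a = dg b -> mdeg a = mdeg b.

Lemma dgE a v : dg a v = (\sum_i D i v * a i)%N.
Proof. by rewrite mnm_sumE; apply: eq_bigr => i _; rewrite mulmnE. Qed.

Lemma dgD a b : dg (a + b)%MM = (dg a + dg b)%MM.
Proof.
apply/mnmP => v; rewrite mnmDE !dgE -big_split; apply: eq_bigr => i _.
by rewrite mnmDE mulnDr.
Qed.

Definition tmap : {mpoly K[m]} -> {mpoly K[n]} :=
  mmap (mpolyC n (R := K)) (fun i => 'X_[D i]).

HB.instance Definition _ := GRing.RMorphism.on tmap.

Lemma tmapX a : tmap 'X_[a] = 'X_[dg a].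
Proof. by rewrite /tmap mmapX /mmap1 mprodXnE. Qed.

Lemma tmapE q : tmap q = \sum_(a <- msupp q) q@_a *: 'X_[dg a].
Proof.
rewrite {1}[q]mpolyE raddf_sum; apply: eq_bigr => a _.
by rewrite /= [tmap _]mmapZ [mmap _ _ _]tmapX mul_mpolyC.
Qed.

Definition fib a : 'X_{1..m} := choose (fun c => dg c == dg a) a.

Lemma dg_fib a : dg (fib a) = dg a.
Proof. by apply/eqP; apply: (chooseP (P := fun c => dg c == dg a)). Qed.

Lemma fib_eq a b : dg a = dg b -> fib a = fib b.
Proof.
move=> E; rewrite /fib E; apply: (choose_id (P := fun c => dg c == dg b)) => //.
exact/eqP.
Qed.

(** The coefficients of [q] in each fibre of [dg] add up to a coefficient of its image, hence to
    zero, so the monomials [fib a] cancel. *)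
Lemma tmap_binomials q : tmap q = 0 ->
  q = \sum_(a <- msupp q) q@_a *: ('X_[a] - 'X_[fib a]).
Proof.
move=> q0; under eq_bigr do rewrite scalerBr.
rewrite sumrB -mpolyE; set S := \sum_(a <- _) _.
suff -> : S = 0 by rewrite subr0.
apply/mpolyP => c; rewrite mcoeff0 raddf_sum /=.
have [cE|cE] := eqVneq c (fib c).
  transitivity ((tmap q)@_(dg c)); last by rewrite q0 mcoeff0.
  rewrite tmapE raddf_sum; apply: eq_bigr => a _ /=; rewrite !mcoeffZ !mcoeffX.
  congr (_ * _%:R); congr (nat_of_bool _); apply/eqP/eqP => [<-|/fib_eq->//].
  by rewrite dg_fib.
rewrite big1 // => a _; rewrite mcoeffZ mcoeffX.
case: eqVneq => [E|]; last by rewrite mulr0.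
by case/eqP: cE; rewrite -E; apply: fib_eq; rewrite dg_fib.
Qed.

(* The linear form [psi x] below sums the coefficients over the [approx]-class
   of [x]; it vanishes on [m I], where [m] is the ideal of the variables, because
   multiplying a binomial by a variable links its two monomials. *)
Inductive approx : 'X_{1..m} -> 'X_{1..m} -> Prop :=
| approx_refl a : approx a a
| approx_step a b c i : dg a = dg b -> (0 < a i)%N -> (0 < b i)%N ->
    approx b c -> approx a c.

Lemma approx_dg a b : approx a b -> dg a = dg b.
Proof. by elim=> // a' b' c i ->. Qed.

Lemma approx_trans b a c : approx a b -> approx b c -> approx a c.
Proof. by elim=> // a' b' c' i E ai bi _ IH /IH; apply: approx_step ai bi. Qed.

Lemma approx_sym a b : approx a b -> approx b a.
Proof.
elim=> [c|a' b' c i E ai bi _ IH]; first exact: approx_refl.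
by apply: approx_trans IH _; apply: approx_step bi ai (approx_refl _).
Qed.

Lemma approx_add d a b : d != 0%MM -> dg a = dg b -> approx (d + a)%MM (d + b)%MM.
Proof.
move=> d0 E; have [i di] : exists i, (0 < d i)%N.
  apply: contrapT => no; case/eqP: d0; apply/mnmP => i; rewrite mnm0E.
  by apply/eqP; rewrite -leqn0 leqNgt; apply/negP => di; apply: no; exists i.
apply: (@approx_step _ _ _ i _ _ _ (approx_refl _)).
- by rewrite !dgD E.
- by rewrite mnmDE addn_gt0 di.
- by rewrite mnmDE addn_gt0 di.
Qed.

Definition rep a : 'X_{1..m} := choose (fun c => `[< approx a c >]) a.

Lemma approx_rep a : approx a (rep a).
Proof.
apply/asboolP; apply: (chooseP (P := fun c => `[< approx a c >])).
by apply/asboolP; apply: approx_refl.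
Qed.

Lemma rep_eq a b : approx a b -> rep a = rep b.
Proof.
move=> ab; rewrite /rep.
rewrite (_ : (fun c => `[< approx a c >]) = (fun c => `[< approx b c >])).
  by apply: choose_id; apply/asboolP; [apply: approx_sym|apply: approx_refl].
apply: funext => c; apply: asbool_equiv_eq; split; apply: approx_trans => //.
exact: approx_sym.
Qed.

Definition base a : 'X_{1..m} := rep (fib a).

Lemma dg_rep a : dg (rep a) = dg a.
Proof. by rewrite -(approx_dg (approx_rep a)). Qed.

Lemma dg_base a : dg (base a) = dg a.
Proof. by rewrite dg_rep dg_fib. Qed.

Lemma base_eq a b : dg a = dg b -> base a = base b.
Proof. by move=> E; rewrite /base (fib_eq E). Qed.

Lemma rep_rep a : rep (rep a) = rep a.
Proof. by apply/esym/rep_eq/approx_rep. Qed.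

(** A fibre made of r [approx]-classes contributes r - 1 of these monomials, one for each class
    other than that of [base]. *)
Definition gen a := rep a = a /\ base a <> a.

Definition psi x (p : {mpoly K[m]}) : K :=
  \sum_(a : 'X_{1..m < (mdeg x).+1} | `[< approx x a >]) p@_a.

Lemma psi_is_zmod x : zmod_morphism (psi x).
Proof. by move=> p q; rewrite /psi -sumrB; apply: eq_bigr => a _; rewrite mcoeffB. Qed.
HB.instance Definition _ x := GRing.isZmodMorphism.Build _ _ (psi x) (psi_is_zmod x).

Lemma psiZ x (k : K) p : psi x (k *: p) = k * psi x p.
Proof. by rewrite /psi mulr_sumr; apply: eq_bigr => a _; rewrite mcoeffZ. Qed.

Lemma psiX x c : psi x 'X_[c] = (`[< approx x c >] : bool)%:R.
Proof.
rewrite /psi; case: asboolP => xc; last first.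
  rewrite big1 // => a /asboolP xa; rewrite mcoeffX.
  by case: eqVneq => // E; case: xc; rewrite E.
(* [approx] preserves the degree, so the truncated range of [psi] contains the whole class. *)
have cb : (mdeg c < (mdeg x).+1)%N by rewrite (dg_mdeg (approx_dg xc)).
rewrite (bigD1 (BMultinom cb)) /=; last exact/asboolP.
rewrite mcoeffX eqxx big1 ?addr0 // => a /andP[_ ac]; rewrite mcoeffX.
by case: eqVneq => // E; case/eqP: ac; apply: val_inj; rewrite /= E.
Qed.

Lemma psi_binomial x a b : approx a b -> psi x ('X_[a] - 'X_[b]) = 0.
Proof.
move=> ab; rewrite raddfB /= !psiX.
suff -> : `[< approx x a >] = `[< approx x b >] by rewrite subrr.
apply: asbool_equiv_eq; split=> /approx_trans; apply=> //.
exact: approx_sym.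
Qed.

(** The terms of [p] of positive degree multiply [q] into the product of the ideal of the variables
    with the toric ideal, where [psi x] vanishes; only the constant term acts. *)
Lemma psiM x p q : tmap q = 0 -> psi x (p * q) = p@_0%MM * psi x q.
Proof.
move=> q0; have H d : psi x ('X_[d] * q) = (d == 0%MM)%:R * psi x q.
  have [->|d0] := eqVneq d 0%MM; first by rewrite mpolyX0 !mul1r.
  rewrite mul0r {1}(tmap_binomials q0) mulr_sumr raddf_sum big1 // => a _ /=.
  rewrite -scalerAr psiZ mulrBr -!mpolyXD psi_binomial ?mulr0 //.
  by apply: approx_add => //; rewrite dg_fib.
rewrite {1}[p]mpolyE mulr_suml raddf_sum /=.
under eq_bigr do rewrite -scalerAl psiZ H mulrA.
rewrite -mulr_suml; congr (_ * _).
have [p0|p0] := boolP (0%MM \in msupp p).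
  rewrite (bigD1_seq 0%MM) ?msupp_uniq //= eqxx mulr1 big1 ?addr0 //.
  by move=> d /negPf ->; rewrite mulr0.
rewrite (memN_msupp_eq0 p0) big_seq big1 // => d dp.
by case: eqVneq dp p0 => [-> ->//|_]; rewrite mulr0.
Qed.

Section Generators.
Variables (h : nat) (g : 'I_h -> {mpoly K[m]}).
Hypothesis g0 : forall k, tmap (g k) = 0.
Hypothesis g_gen : forall q, tmap q = 0 ->
  exists c : 'I_h -> {mpoly K[m]}, q = \sum_k c k * g k.

(** The forms [psi x] are dual to the binomials ['X_[x] - 'X_[base x]]. Expanding these in [g]
    factors the identity matrix of size [size s] through dimension [h]. *)
Lemma gen_bound s : uniq s -> (forall x, x \in s -> gen x) -> (size s <= h)%N.
Proof.
move=> us sg; pose x i := nth 0%MM s i.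
have xs (i : 'I_(size s)) : gen (x i) by apply/sg/mem_nth.
have /choice[c cE] : forall j : 'I_(size s), exists c : 'I_h -> {mpoly K[m]},
    'X_[x j] - 'X_[base (x j)] = \sum_k c k * g k.
  by move=> j; apply: g_gen; rewrite raddfB /= !tmapX dg_base subrr.
pose C : 'M[K]_(size s, h) := \matrix_(j, k) (c j k)@_0%MM.
pose G : 'M[K]_(h, size s) := \matrix_(k, i) psi (x i) (g k).
have CG : C *m G = 1%:M.
  apply/matrixP => j i; rewrite !mxE.
  transitivity (psi (x i) ('X_[x j] - 'X_[base (x j)])).
    rewrite cE raddf_sum; apply: eq_bigr => k _ /=; by rewrite !mxE psiM.
  rewrite raddfB /= !psiX; have [ri bi] := xs i; have [rj bj] := xs j.
  (* Distinct [gen] monomials lie in distinct classes, and no [base] monomial lies in the class of a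
     [gen]. *)
  case: asboolP => [/rep_eq|] Eij; case: asboolP => [E|E].
  - have := approx_dg E; rewrite dg_base => /base_eq E'.
    by case: bi; rewrite E' -[RHS]ri (rep_eq E) rep_rep.
  - move: Eij; rewrite ri rj => /eqP; rewrite nth_uniq // => /eqP E2.
    by rewrite (val_inj E2) eqxx subr0.
  - have := approx_dg E; rewrite dg_base => /base_eq E'.
    by case: bi; rewrite E' -[RHS]ri (rep_eq E) rep_rep.
  - rewrite subrr; case: eqVneq => // E2; case: Eij; rewrite E2; exact: approx_refl.
have := rank_leq_col C; apply: leq_trans.
by have := mxrankM_maxl C G; rewrite CG mxrank1.
Qed.

Lemma gen_list : exists s, [/\ uniq s, (size s <= h)%N & forall x, x \in s <-> gen x].
Proof.
have [s [us sg]] := bounded_finite gen_bound; exists s; split=> //.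
by apply: gen_bound => // x /sg.
Qed.

End Generators.

Definition vec k (a : 'X_{1..k}) : 'rV[rat]_k := \row_i (a i)%:R.

Lemma vecD k (a b : 'X_{1..k}) : vec (a + b)%MM = vec a + vec b.
Proof. by apply/rowP => i; rewrite !mxE mnmDE natrD. Qed.

Section Span.
Variables (k : nat) (u : 'I_k -> 'X_{1..m}).
Hypothesis u_gen : forall x, gen x -> exists i, u i = x.

Definition uvec i := vec (u i) - vec (base (u i)).

(** The bound on degrees is what later locates generators inside a subgraph. *)
Definition inspan (b : 'X_{1..n}) (v : 'rV[rat]_m) :=
  exists2 c : 'I_k -> rat, v = \sum_i c i *: uvec i
    & forall i, c i != 0 -> (dg (u i) <= b)%MM.

Lemma inspanB (b : 'X_{1..n}) v w : inspan b v -> inspan b w -> inspan b (v - w).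
Proof.
move=> [c -> cb] [d -> db]; exists (fun i => c i - d i).
  by rewrite -sumrB; apply: eq_bigr => i _; rewrite scalerBl.
move=> i; have [ci|/cb//] := eqVneq (c i) 0.
by rewrite ci sub0r oppr_eq0 => /db.
Qed.

Lemma inspan0 (b : 'X_{1..n}) : inspan b 0.
Proof.
exists (fun=> 0); first by rewrite big1 // => i _; rewrite scale0r.
by move=> i; rewrite eqxx.
Qed.

Lemma inspan_uvec i : inspan (dg (u i)) (uvec i).
Proof.
exists (fun j => (j == i)%:R).
  by rewrite (bigD1 i) //= eqxx scale1r big1 ?addr0 // => j /negPf->; rewrite scale0r.
by move=> j; case: (eqVneq j i) => [-> _|_]; rewrite ?eqxx //; apply: lepm_refl.
Qed.

Lemma inspan_le (b b' : 'X_{1..n}) v : (b <= b')%MM -> inspan b v -> inspan b' v.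
Proof. by move=> le [c -> cb]; exists c => // i /cb /lepm_trans; apply. Qed.

Lemma inspan_rep a : inspan (dg a) (vec (rep a) - vec (base a)).
Proof.
have [E|/eqP E] := eqVneq (base a) (rep a); first by rewrite E subrr; apply: inspan0.
have Er : base (rep a) = base a by apply: base_eq; rewrite dg_rep.
have [|i ui] := @u_gen (rep a); first by split; rewrite ?rep_rep ?Er.
by have := inspan_uvec i; rewrite /uvec ui Er dg_rep.
Qed.

(** Induction on the degree. Along an [approx] step both monomials share a variable, which cancels
    and lowers the degree; different classes of a fibre are joined through [base] by elements of
    [u]. *)
Lemma inspan_dg a b : dg a = dg b -> inspan (dg a) (vec a - vec b).
Proof.
have [d] := ubnP (mdeg a); elim: d => // d IH in a b * => ltd ab.
have Hrep c : dg c = dg a -> inspan (dg a) (vec c - vec (rep c)).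
  move=> ca; rewrite -ca; have mc : (mdeg c <= d)%N by rewrite (dg_mdeg ca).
  elim: (approx_rep c) mc => [x _|x y z i xy xi yi _ IHz mx].
    by rewrite subrr; apply: inspan0.
  have -> : vec x - vec z = (vec x - vec y) - (vec z - vec y).
    by rewrite opprB addrA subrK.
  apply: inspanB.
    have ux : (U_(i) <= x)%MM by rewrite lep1mP -lt0n.
    have uy : (U_(i) <= y)%MM by rewrite lep1mP -lt0n.
    rewrite -(submK ux) -(submK uy) !vecD opprD addrACA subrr addr0.
    have E : dg (x - U_(i))%MM = dg (y - U_(i))%MM.
      by apply: (@addIm _ (dg U_(i))); rewrite -!dgD !submK.
    apply: inspan_le (IH _ _ _ E).
      by rewrite dgD lem_addr.
    by move: mx; rewrite -{1}(submK ux) mdegD mdeg1 addn1.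
  rewrite -opprB -sub0r; apply: inspanB; first exact: inspan0.
  by rewrite xy; apply: IHz; rewrite -(dg_mdeg xy).
have Ea := Hrep a erefl; have Eb := Hrep b (esym ab).
have Ra := inspan_rep a; have Rb := inspan_rep b.
rewrite -ab (base_eq (esym ab)) in Rb.
have -> : vec a - vec b = ((vec a - vec (rep a)) - (vec b - vec (rep b))) -
   ((vec (rep b) - vec (base a)) - (vec (rep a) - vec (base a))).
  by apply/rowP => i; rewrite !mxE; ring.
by apply: (inspanB); apply: inspanB.
Qed.

End Span.
End Toric.

Lemma clear_denominators k (v : 'rV[rat]_k) :
  exists2 N : rat, N != 0 & exists a b : 'X_{1..k}, N *: v = vec a - vec b.
Proof.
pose N := \prod_i denq (v 0 i).
pose z i : int := numq (v 0 i) * \prod_(j | j != i) denq (v 0 j).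
have zE i : N%:~R * v 0 i = (z i)%:~R.
  rewrite /N (bigD1 i) //= /z !rmorphM /= numqE mulrAC; congr (_ * _).
  by rewrite mulrC.
exists N%:~R.
  by rewrite intr_eq0; apply/prodf_neq0 => i _; apply: denq_neq0.
(* An integer [z] is the difference of the naturals [z + |z|] and [|z|]. *)
exists [multinom absz (z i + `|z i|)%R | i < k], [multinom absz (z i) | i < k].
apply/rowP => i; rewrite !mxE !mnmE zE.
have E : z i = (absz (z i + `|z i|))%:Z - (absz (z i))%:Z by lia.
by rewrite {1}E rmorphB.
Qed.

(** * Rank of the exponent matrix and independence of the minimal binomials *)

Section ToricRank.
Variables (K : fieldType) (m n : nat) (D : 'I_m -> 'X_{1..n}).

Definition toric_mx : 'M[rat]_(m, n) := \matrix_i vec (D i).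

Lemma vec_dg a : vec a *m toric_mx = vec (dg D a).
Proof.
apply/rowP => j; rewrite !mxE dgE natr_sum; apply: eq_bigr => i _.
by rewrite !mxE natrM mulrC.
Qed.

Lemma vec_inj k : injective (@vec k).
Proof.
move=> a b /rowP E; apply/mnmP => i; move: (E i); rewrite !mxE => /eqP.
by rewrite eqr_nat => /eqP.
Qed.

Hypothesis dg_mdeg : forall a b, dg D a = dg D b -> mdeg a = mdeg b.

(** By [inspan_dg], after clearing denominators, the [k] vectors span the left kernel of [toric_mx],
    of dimension [m - \rank toric_mx]; being no more numerous than that, they are independent. *)
Lemma uvec_free k (u : 'I_k -> 'X_{1..m}) :
  (forall x, gen D x -> exists i, u i = x) -> (k <= m - \rank toric_mx)%N ->
  forall c : 'I_k -> rat, \sum_i c i *: uvec D u i = 0 -> forall i, c i = 0.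
Proof.
move=> u_gen le_k c c0; pose M := \matrix_i uvec D u i.
have sub : (kermx toric_mx <= M)%MS.
  apply/row_subP => r; set v := row r _.
  have vA : v *m toric_mx = 0 by rewrite -row_mul mulmx_ker row0.
  have [N N0 [a [b Nv]]] := clear_denominators v.
  have ab : dg D a = dg D b.
    apply: vec_inj; apply/eqP; rewrite -subr_eq0 -!vec_dg -mulmxBl -Nv.
    by rewrite -scalemxAl vA scaler0.
  have [d dE _] := inspan_dg dg_mdeg u_gen ab.
  rewrite (_ : v = N^-1 *: (\row_i d i *m M)) ?scalemx_sub ?submxMl //.
  rewrite -[v](scalerK N0) Nv dE mulmx_sum_row; congr (_ *: _).
  by apply: eq_bigr => i _; rewrite mxE rowK.
have fM : row_free M.
  rewrite /row_free eqn_leq rank_leq_row; apply: leq_trans le_k _.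
  by rewrite -mxrank_ker mxrankS.
have E : \row_i c i *m M = 0 *m M.
  rewrite mul0mx -[RHS]c0 mulmx_sum_row; apply: eq_bigr => i _.
  by rewrite mxE rowK.
by move=> i; move/(row_free_inj fM)/rowP/(_ i): E; rewrite !mxE.
Qed.

Definition toric_ker (p : mpoly K m) := tmap D (to_mp p) = 0.

Lemma toric_ker_prime : is_prime_ideal toric_ker.
Proof.
split; first split.
- by rewrite /toric_ker !raddf0.
- by move=> x y; rewrite /toric_ker !raddfD /= => -> ->; rewrite addr0.
- by move=> r x; rewrite /toric_ker !rmorphM /= => ->; rewrite mulr0.
- by rewrite /toric_ker !rmorph1 => /eqP; rewrite oner_eq0.
move=> x y; rewrite /toric_ker !rmorphM /= => /eqP.
by rewrite mulf_eq0 => /orP[] /eqP; [left|right].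
Qed.

(** Choose variables whose rows form a basis of the row space. Distinct monomials in them have
    distinct images, so no cancellation can occur. *)
Lemma toric_ker_indep :
  exists a, alg_indep_mod toric_ker (\rank toric_mx) a.
Proof.
have [f fi] : exists f : 'I_(\rank toric_mx) -> 'I_m, row_free (rowsub f toric_mx).
  by exists (maxrankfun toric_mx); apply: maxrowsub_free.
exists (ordfun (fun i => mvar K m (f i))) => F; rewrite /toric_ker => F0.
have {}F0 : tmap (D \o f) (to_mp F) = 0.
  rewrite -[RHS]F0 [LHS]mmap_to_mp.
  have := meval_comp _ (@tmap K m n D \o @to_mp K m); move=> /= ->; apply/esym.
  apply: (eq_meval (f := (@tmap K m n D \o @to_mp K m) \o mconst K m)
    (g := mpolyC n (R := K))) => [c|i lin] /=.
    by rewrite /to_mp meval_const [LHS]mmapC.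
  rewrite -[i]/(val (Ordinal lin)) !ordfunE /to_mp meval_var // ordfunE.
  by rewrite tmapX; congr 'X_[_]; apply/mnmP => v; rewrite dgE (bigD1 (f (Ordinal lin)))
    //= mnm1E eqxx muln1 big1 ?addn0 // => j; rewrite mnm1E eq_sym => /negPf ->; rewrite muln0.
have dgi : injective (dg (D \o f)).
  move=> s t st; apply: vec_inj.
  apply: (row_free_inj fi).
  have E s' : vec s' *m rowsub f toric_mx = vec (dg (D \o f) s').
    apply/rowP => j; rewrite !mxE dgE natr_sum; apply: eq_bigr => i _.
    by rewrite !mxE natrM mulrC.
  by rewrite !E st.
apply: to_mp_inj; rewrite raddf0; apply/mpolyP => s; rewrite mcoeff0.
have := congr1 (mcoeff (dg (D \o f) s)) F0; rewrite mcoeff0 tmapE raddf_sum /=.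
have [sF|sF _] := boolP (s \in msupp (to_mp F)); last exact: memN_msupp_eq0.
rewrite (bigD1_seq s) ?msupp_uniq //= mcoeffZ mcoeffX eqxx mulr1.
rewrite big1 ?addr0 // => t ts; rewrite mcoeffZ mcoeffX.
by rewrite (inj_eq dgi) (negPf ts) mulr0.
Qed.

(** Here [size g] is the height, which is at most [m - \rank toric_mx] by [ideal_height_le]; the
    minimal binomials are no more numerous than [g], so [uvec_free] applies. *)
Theorem markov_basis : complete_intersection toric_ker ->
  exists k (u : 'I_k -> 'X_{1..m} * 'X_{1..m}),
  [/\ forall i, dg D (u i).1 = dg D (u i).2,
      forall c : 'I_k -> rat,
        \sum_i c i *: (vec (u i).1 - vec (u i).2) = 0 -> forall i, c i = 0
    & forall a b, dg D a = dg D b -> exists2 c : 'I_k -> rat,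
        vec a - vec b = \sum_i c i *: (vec (u i).1 - vec (u i).2)
        & forall i, c i != 0 -> (dg D (u i).1 <= dg D a)%MM].
Proof.
case=> g [g_gen hg].
have [x ix] := toric_ker_indep.
have le := ideal_height_le toric_ker_prime hg ix.
have [s [us ss sg]] : exists s,
    [/\ uniq s, (size s <= size g)%N & forall x, x \in s <-> gen D x].
  apply: (gen_list (K := K) dg_mdeg (g := fun k : 'I_(size g) => to_mp g`_k)).
    move=> k; apply/(g_gen g`_k); exists (fun i : nat => (i == k :> nat)%:R).
    rewrite (bigD1 k) //= eqxx mul1r big1 ?addr0 // => i ik.
    by rewrite (_ : (i == k :> nat) = false) ?mul0r //; apply: contraNF ik.
  move=> q q0; have [|c cE] := (g_gen (of_mp q)).1; first by rewrite /toric_ker of_mpK.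
  exists (fun k => to_mp (c k)); rewrite -[q in LHS]of_mpK cE rmorph_sum.
  by apply: eq_bigr => k _; rewrite rmorphM.
pose w (i : 'I_(size s)) := nth 0%MM s i.
have w_gen y : gen D y -> exists i, w i = y.
  move=> /sg ys; have lt : (index y s < size s)%N by rewrite index_mem.
  by exists (Ordinal lt); rewrite /w nth_index.
exists (size s), (fun i => (w i, base D (w i))); split => /=.
- by move=> i; rewrite dg_base.
- by apply: uvec_free w_gen _; lia.
- by move=> a b /(inspan_dg dg_mdeg w_gen).
Qed.

End ToricRank.

(** * Toric ideals of graphs, with monomials as lists of edges *)

Section GraphToric.
Variables (K : fieldType) (T : finType) (e : rel T).
Hypothesis e_irr : irreflexive e.

Let m := #|gedges e|.
Let edge (i : 'I_m) : {set T} := enum_val i.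

Definition edge_degree (i : 'I_m) : 'X_{1..#|T|} :=
  [multinom (enum_val v \in edge i : nat) | v < #|T|].

Lemma toric_idealE : @toric_ideal T e K = toric_ker (K := K) edge_degree.
Proof.
apply: funext => p; rewrite /toric_ideal /toric_ker.
suff E : to_mp (toric_map p) = tmap edge_degree (to_mp p).
  apply: propext; rewrite -E; split=> [->|E0]; first by rewrite raddf0.
  by apply: to_mp_inj; rewrite raddf0.
rewrite [RHS]mmap_to_mp /toric_map meval_comp.
apply: (eq_meval (f := @to_mp K _ \o mconst K _) (g := mpolyC _ (R := K))).
  by move=> c /=; rewrite /to_mp meval_const.
move=> i lin; rewrite -[i]/(val (Ordinal lin)); move: (Ordinal lin) => {lin}i.
rewrite ordfunE /= /edge_image valK.
rewrite rmorph_prod /=.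
rewrite (eq_bigr (fun v => 'X_[U_(enum_rank v)])); last first.
  by move=> v _; rewrite /to_mp meval_var // ordfunE.
rewrite mprodXE; congr 'X_[_]; apply/mnmP => j; rewrite mnm_sumE mnmE.
rewrite /edge; have [jE|jE] := boolP (enum_val j \in _).
  rewrite (bigD1 _ jE) /= mnm1E enum_valK eqxx big1 // => v /andP[_ vj].
  by rewrite mnm1E; case: eqVneq => // E; rewrite -E enum_rankK eqxx in vj.
rewrite big1 // => v vE; rewrite mnm1E; case: eqVneq => // E.
by rewrite -E enum_rankK vE in jE.
Qed.

Lemma card_gedge E : E \in gedges e -> #|E| = 2%N.
Proof.
rewrite inE => /existsP[x /existsP[y /andP[exy /eqP->]]].
by rewrite cards2; case: eqVneq exy => // ->; rewrite e_irr.
Qed.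

(** Every edge has two ends, so the toric map doubles degrees. *)
Lemma edge_degree_mdeg a b :
  dg edge_degree a = dg edge_degree b -> mdeg a = mdeg b.
Proof.
suff H c : mdeg (dg edge_degree c) = (2 * mdeg c)%N.
  by move=> E; have := H a; rewrite E H; lia.
rewrite mdeg_sum mdegE big_distrr /=; apply: eq_bigr => i _.
rewrite mdegMn; congr (_ * _)%N; rewrite mdegE.
rewrite -(card_gedge (enum_valP i)) -[RHS]sum1_card [RHS]big_mkcond.
rewrite (reindex (@enum_rank T)) /=; last first.
  by apply: onW_bij; exists enum_val; [apply: enum_rankK|apply: enum_valK].
by apply: eq_bigr => v _; rewrite mnmE enum_rankK; case: (v \in _).
Qed.

(** Lists of edges stand for monomials up to permutation, so that walks can be used directly: [ldg]
    is the multidegree read at vertices and [cdiff] the exponent vector of a binomial. *)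
Definition edges_in (s : seq {set T}) := all (mem (gedges e)) s.

Definition ldg (s : seq {set T}) (v : T) := count (fun E : {set T} => v \in E) s.

Definition mon_of s : 'X_{1..m} := [multinom count_mem (edge i) s | i < m].

Definition list_of (a : 'X_{1..m}) : seq {set T} :=
  flatten [seq nseq (a i) (edge i) | i <- enum 'I_m].

Lemma list_of_in a : edges_in (list_of a).
Proof.
apply/allP => E /flattenP[_ /mapP[i _ ->]] /nseqP[-> _]; exact: enum_valP.
Qed.

Lemma list_ofK : cancel list_of mon_of.
Proof.
move=> a; apply/mnmP => i; rewrite mnmE /list_of count_flatten -map_comp.
rewrite sumnE big_map (bigD1_seq i) ?mem_enum ?enum_uniq //=.
rewrite count_nseq /= eqxx mul1n big1 ?addn0 // => j ji.
rewrite count_nseq /= (inj_eq enum_val_inj) (negPf ji) //.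
Qed.

Lemma dg_mon_of s j : edges_in s -> dg edge_degree (mon_of s) j = ldg s (enum_val j).
Proof.
rewrite dgE; elim: s => [_|E s IH /= /andP[Es /IH{}IH]].
  by rewrite big1 // => i _; rewrite !mnmE muln0.
rewrite -IH -[LHS]/(\sum_i _)%N.
under eq_bigr do rewrite !mnmE /= mulnDr.
rewrite big_split /=; congr (_ + _)%N; last first.
  by apply: eq_bigr => i _; rewrite !mnmE.
rewrite (bigD1 (enum_rank_in Es E)) //= /edge enum_rankK_in // eqxx muln1.
rewrite big1 ?addn0 // => i iE; case: eqVneq => [E'|]; last by rewrite muln0.
by case/eqP: iE; apply: enum_val_inj; rewrite enum_rankK_in.
Qed.

Definition cdiff (u : seq {set T} * seq {set T}) E : rat :=
  (count_mem E u.1)%:R - (count_mem E u.2)%:R.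

Lemma cdiff_vec a b i : cdiff (a, b) (edge i) = (vec (mon_of a) - vec (mon_of b)) 0 i.
Proof. by rewrite !mxE !mnmE. Qed.

Lemma cdiff_notin a b E : edges_in a -> edges_in b -> E \notin gedges e ->
  cdiff (a, b) E = 0.
Proof.
move=> /allP ain /allP bin En; rewrite /cdiff !(count_memPn _) ?subrr //.
- by apply: contra En => /bin.
- by apply: contra En => /ain.
Qed.

Theorem graph_markov_basis : graph_CI e K ->
  exists k (u : 'I_k -> seq {set T} * seq {set T}),
  [/\ forall i, edges_in (u i).1 /\ edges_in (u i).2,
      forall i v, ldg (u i).1 v = ldg (u i).2 v,
      forall c : 'I_k -> rat, (forall E, \sum_i c i * cdiff (u i) E = 0) ->
        forall i, c i = 0
    & forall a b, edges_in a -> edges_in b -> ldg a =1 ldg b ->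
        exists2 c : 'I_k -> rat,
          forall E, cdiff (a, b) E = \sum_i c i * cdiff (u i) E
        & forall i, c i != 0 -> forall v, (ldg (u i).1 v <= ldg a v)%N].
Proof.
rewrite /graph_CI toric_idealE => /(markov_basis edge_degree_mdeg).
move=> [k [u [u_dg u_free u_span]]].
pose w i := (list_of (u i).1, list_of (u i).2).
have win i : edges_in (w i).1 /\ edges_in (w i).2 by split; apply: list_of_in.
have wE i j : cdiff (w i) (edge j) = (vec (u i).1 - vec (u i).2) 0 j.
  by rewrite cdiff_vec !list_ofK.
have mE a v : edges_in a -> ldg a v = dg edge_degree (mon_of a) (enum_rank v).
  by move=> ain; rewrite dg_mon_of // enum_rankK.
exists k, w; split=> //.
- by move=> i v; rewrite !mE ?list_of_in // !list_ofK u_dg.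
- move=> c c0; apply: u_free; apply/rowP => j; rewrite summxE mxE -[RHS](c0 (edge j)).
  by apply: eq_bigr => i _; rewrite wE !mxE.
move=> a b ain bin ab; have [|c cE cd] := u_span (mon_of a) (mon_of b).
  by apply/mnmP => j; rewrite !dg_mon_of.
exists c => [E|i /cd /mnm_lepP le v]; last first.
  by rewrite !mE // ?list_of_in // list_ofK; apply: le.
have [Ein|En] := boolP (E \in gedges e); last first.
  rewrite cdiff_notin // big1 // => i _; rewrite cdiff_notin ?mulr0 //;
  by apply: list_of_in.
rewrite -(enum_rankK_in Ein Ein) -/(edge _) cdiff_vec cE summxE.
by apply: eq_bigr => i _; rewrite wE !mxE.
Qed.

End GraphToric.

End ToricAlgebra.
Import ToricAlgebra.

Local Open Scope nat_scope.

(** * Odd closed walks and odd chordless cycles *)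

Section OddWalks.
Variables (T : finType) (e : rel T).
Hypotheses (e_sym : symmetric e) (e_irr : irreflexive e).
Implicit Types (S : {set T}) (x y z v : T) (s p q : seq T).

Lemma inducedE S x y : induced e S x y = [&& x \in S, y \in S & e x y].
Proof. by []. Qed.

Lemma induced_sym S : symmetric (induced e S).
Proof. by move=> x y; rewrite !inducedE e_sym andbCA. Qed.

Lemma induced_sub S S' : S \subset S' -> subrel (induced e S) (induced e S').
Proof. by move=> /subsetP sub x y; rewrite !inducedE => /and3P[/sub-> /sub->]. Qed.

Lemma induced_e S : subrel (induced e S) e.
Proof. by move=> x y /and3P[]. Qed.

Lemma path_induced_mem S x p : path (induced e S) x p -> {subset p <= S}.
Proof.
elim: p x => //= y p IH x /andP[/and3P[_ yS _]] /IH pS z.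
by rewrite inE => /predU1P[->//|/pS].
Qed.

Lemma path_rev S x p : path (induced e S) x p ->
  path (induced e S) (last x p) (rev (belast x p)).
Proof.
by rewrite rev_path; apply: sub_path => u v; rewrite induced_sym.
Qed.

Lemma path_inducedI S x p : x \in S -> {subset p <= S} -> path e x p ->
  path (induced e S) x p.
Proof.
elim: p x => //= y p IH x xS pS /andP[exy yp].
have yS : y \in S by apply: pS; rewrite inE eqxx.
by rewrite inducedE xS yS exy IH // => z zp; apply: pS; rewrite inE zp orbT.
Qed.

(** Vertices may recur, but the base point is not listed again at the end, so [size s] is the number
    of edges. *)
Definition oddwalk S s := cycle (induced e S) s && odd (size s).

Lemma oddwalk_rot S i s : oddwalk S (rot i s) = oddwalk S s.
Proof. by rewrite /oddwalk rot_cycle size_rot. Qed.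

Lemma oddwalk_subset S s : oddwalk S s -> {subset s <= S}.
Proof.
case/andP=> + _ x xs; case: s xs => // y s xs /= /path_induced_mem; apply.
by rewrite mem_rcons.
Qed.

Lemma oddwalkS S S' s : S \subset S' -> oddwalk S s -> oddwalk S' s.
Proof.
by move=> sub /andP[+ odds]; rewrite /oddwalk odds andbT; case: s odds => //= x s _;
  apply: sub_path; apply: induced_sub.
Qed.

Lemma oddwalk_cons S x s :
  oddwalk S (x :: s) = path (induced e S) x (rcons s x) && ~~ odd (size s).
Proof. by []. Qed.

(** The two closed walks based at [x] share out an odd number of edges. *)
Lemma oddwalk_split S x s1 s2 : oddwalk S (x :: s1 ++ x :: s2) ->
  oddwalk S (x :: s1) || oddwalk S (x :: s2).
Proof.
rewrite !oddwalk_cons rcons_cat cat_path /= !rcons_path size_cat /= addnS oddS.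
rewrite negbK oddD => /andP[/and4P[-> -> -> ->]] /=.
by case: (odd (size s1)); case: (odd (size s2)).
Qed.

Lemma oddwalk_simple S x s : oddwalk S (x :: s) ->
  exists2 s', oddwalk S (x :: s') & x \notin s'.
Proof.
have [k] := ubnP (size s); elim: k => // k IH in s * => sk ws.
have [xs|] := boolP (x \in s); last by exists s.
case/splitPr: xs ws sk => s1 s2 /oddwalk_split /orP[] w; rewrite size_cat /= => sk.
  by apply: IH w; lia.
by apply: IH w; lia.
Qed.

(** Colour a vertex by the existence of an odd walk from a fixed [x0]. Two neighbours reached with
    equal parity close up to an odd walk. *)
Lemma nonbipartite_oddwalk S : connected_in e S -> ~ bipartite_in e S ->
  exists s, oddwalk S s.
Proof.
move=> /forall_inP conn nb; apply: contrapT => no; apply: nb.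
have [->|[x0 x0S]] := set_0Vmem S; first by exists (fun=> true) => x y; rewrite inE.
pose odd_to z := exists2 p, path (induced e S) x0 p & last x0 p = z /\ odd (size p).
exists (fun z => `[< odd_to z >]) => x y xS yS exy.
have bad p q : path (induced e S) x0 p -> last x0 p = x ->
    path (induced e S) x0 q -> last x0 q = y -> odd (size p) = odd (size q) -> False.
  move=> pp px pq qy par; apply: no.
  exists (p ++ y :: rev (belast x0 q)); rewrite /oddwalk size_cat /= size_rev.
  rewrite size_belast addnS oddS oddD par addbb /= andbT.
  have : path (induced e S) x0 (p ++ y :: rev (belast x0 q)).
    by rewrite cat_path pp px /= inducedE xS yS exy -{1}qy path_rev.
  have : last x0 (p ++ y :: rev (belast x0 q)) = x0.
    rewrite last_cat /=; case: q qy {pq par} => [<-//|z q _].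
    by rewrite /= rev_cons last_rcons.
  case/lastP: (_ ++ _) => // r w; rewrite last_rcons => -> pr.
  by rewrite -rot1_cons rot_cycle.
have [p [pp px]] : exists p, path (induced e S) x0 p /\ last x0 p = x.
  by move/forall_inP: (conn _ x0S) => /(_ _ xS) /connectP[p pp ->]; exists p.
have [q [pq qy]] : exists q, path (induced e S) x0 q /\ last x0 q = y.
  by move/forall_inP: (conn _ x0S) => /(_ _ yS) /connectP[q pq ->]; exists q.
apply/eqP; case: asboolP => [[p' pp' [px' op']]|nx]; case: asboolP => [[q' pq' [qy' oq']]|ny] // _.
  by apply: (bad p' q') => //; rewrite op' oq'.
apply: (bad p q) => //; transitivity false.
  by apply/negP => op; apply: nx; exists p.
by apply/esym/negP => oq; apply: ny; exists q.
Qed.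

(** A repeated vertex or a chord cuts the walk into two shorter closed walks, one of them odd. *)
Lemma shortest_oddwalk_chordless S s : oddwalk S s ->
  (forall s', oddwalk S s' -> size s <= size s') -> chordless_cycle_seq e s.
Proof.
move=> ws smin.
have us : uniq s.
  apply: count_mem_uniq => x; have [xs|/count_memPn//] := boolP (x \in s).
  have [i s' Es] := rot_to xs.
  have /permP <- : perm_eq (rot i s) s by rewrite perm_rot.
  rewrite Es /= eqxx; suff /count_memPn -> : x \notin s' by [].
  apply/negP => xs'; move: ws smin; rewrite -(oddwalk_rot S i) -(size_rot i) Es.
  case/splitPr: xs' => s1 s2 /oddwalk_split /orP[] w /(_ _ w); rewrite /= size_cat /=; lia.
have c2 : 2 < size s.
  case/andP: ws; case: s {smin us} => [|x [|x' [|x'' s]]] //=.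
  by rewrite inducedE e_irr /= !andbF.
have cs : cycle e s.
  case/andP: ws => + _; case: (s) => //= x s'; apply: sub_path; exact: induced_e.
apply/and4P; split=> //; apply/allP => x xs; apply/allP => y ys; apply/implyP => exy.
have xS := oddwalk_subset ws xs; have yS := oddwalk_subset ws ys.
have [i s' Es] := rot_to xs.
have yi : y \in x :: s' by rewrite -Es mem_rot.
move: yi; rewrite inE; case: eqVneq exy => [->|_ exy /= ys']; first by rewrite e_irr.
rewrite -!(next_rot i us) Es.
move: ws smin us; rewrite -(oddwalk_rot S i) -(size_rot i) -(rot_uniq i) Es.
(* If nothing lies between [x] and [y], then [y] follows [x]; if nothing comes after [y], then [x]
   follows [y]; otherwise the edge [x y] is a chord. *)
case/splitPr: ys' => -[|a s1] s2 ws smin us; first by rewrite /= eqxx eqxx.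
case: s2 ws smin us => [|b s2] ws smin us.
  apply/orP; right; rewrite -[X in next X _](rotrK 1) next_rot ?rotr_uniq //.
  have -> : rotr 1 (x :: (a :: s1) ++ [:: y]) = [:: y, x, a & s1].
    by rewrite cats1 -rcons_cons rotr1_rcons.
  by rewrite /= eqxx.
exfalso; move: ws smin; rewrite oddwalk_cons /= rcons_cat cat_path size_cat /=.
case/andP=> /and5P[xa as1 sy yb bs2]; move=> os smin.
have w1 : path (induced e S) x (rcons (a :: rcons s1 y) x).
  by rewrite /= xa !rcons_path as1 last_rcons sy /= inducedE yS xS e_sym exy.
have w2 : path (induced e S) x (rcons (y :: b :: s2) x).
  by rewrite /= inducedE xS yS exy yb.
(* The halves have sizes [size s1 + 3] and [size s2 + 3]. Both are shorter than the walk, so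
   minimality makes both even, against the odd total. *)
have f1 : odd (size s1).
  apply: contraT => o1; have := smin (x :: a :: rcons s1 y).
  rewrite oddwalk_cons w1 /= size_rcons /= negbK o1 => /(_ isT).
  by move: (size s1) (size s2); clear; lia.
have f2 : odd (size s2).
  apply: contraT => o2; have := smin (x :: y :: b :: s2).
  rewrite oddwalk_cons w2 /= negbK o2 => /(_ isT).
  by move: (size s1) (size s2); clear; lia.
by move: os; rewrite !addnS /= !negbK oddD f1 f2.
Qed.

Lemma odd_chordless_in S : connected_in e S -> ~ bipartite_in e S ->
  exists s, [/\ oddwalk S s, chordless_cycle_seq e s
    & forall s', oddwalk S s' -> size s <= size s'].
Proof.
move=> conn nb; have [s0 w0] := nonbipartite_oddwalk conn nb.
have ex : exists k, `[< exists2 s, oddwalk S s & size s = k >].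
  by exists (size s0); apply/asboolP; exists s0.
case: (ex_minnP ex) => k /asboolP[s ws sk] kmin.
have smin s' : oddwalk S s' -> size s <= size s'.
  by move=> w'; rewrite sk; apply: kmin; apply/asboolP; exists s'.
by exists s; split=> //; apply: shortest_oddwalk_chordless smin.
Qed.

End OddWalks.

(** * Alternating edge lists on walks, and weights on odd chordless cycles *)

Fixpoint alt (X : Type) (b : bool) (l : seq X) : seq X :=
  if l is x :: l' then
    if b then x :: alt false l' else alt true l'
  else [::].

Section EdgeLists.
Variables (T : finType) (e : rel T).
Hypotheses (e_sym : symmetric e) (e_irr : irreflexive e).
Implicit Types (S : {set T}) (E : {set T}) (a b : seq {set T}) (x y z v : T).

Lemma gedgeP E : reflect (exists x y, e x y /\ E = [set x; y]) (E \in gedges e).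
Proof.
rewrite inE; apply: (iffP existsP) => [[x /existsP[y /andP[exy /eqP->]]]|[x [y [exy ->]]]].
  by exists x, y.
by exists x; apply/existsP; exists y; rewrite exy eqxx.
Qed.

Lemma gedge_at E v : E \in gedges e -> v \in E -> exists2 w, e v w & E = [set v; w].
Proof.
case/gedgeP => x [y [exy ->]]; rewrite !inE => /orP[] /eqP->; first by exists y.
by exists x; rewrite 1?e_sym // setUC.
Qed.

Lemma mem_gedge x y : e x y -> [set x; y] \in gedges e.
Proof. by move=> exy; apply/gedgeP; exists x, y. Qed.

Lemma edges_in_cat a b : edges_in e (a ++ b) = edges_in e a && edges_in e b.
Proof. exact: all_cat. Qed.

Lemma ldg_cat a b v : ldg (a ++ b) v = ldg a v + ldg b v.
Proof. exact: count_cat. Qed.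

Lemma cdiff_cat a b a' b' E :
  cdiff (a ++ a', b ++ b') E = (cdiff (a, b) E + cdiff (a', b') E)%R.
Proof. by rewrite /cdiff /= !count_cat !natrD; ring. Qed.

Lemma count_sum_mem (X : finType) (P : pred X) (s : seq X) :
  count P s = \sum_(x | P x) count_mem x s.
Proof.
elim: s => [|z s IH] /=; first by rewrite big1.
rewrite IH big_split /=; congr (_ + _).
rewrite -big_mkcondr /= -[LHS]/(nat_of_bool _); case: (boolP (P z)) => Pz.
  rewrite (bigD1 z) ?Pz ?eqxx //= big1 // => x /andP[/andP[_ /eqP->]].
  by rewrite eqxx.
rewrite big1 // => x /andP[Px /eqP E]; by rewrite E Px in Pz.
Qed.

Lemma sum_ldg a : edges_in e a -> \sum_v ldg a v = 2 * size a.
Proof.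
elim: a => [_|E a IH /= /andP[Ein /IH{}IH]]; first by rewrite big1.
rewrite -[LHS]/(\sum_v ((v \in E) + ldg a v)) big_split /= IH mulnS; congr (_ + _).
by rewrite -(card_gedge e_irr Ein) -[RHS]sum1_card [RHS]big_mkcond.
Qed.

Definition wedges x (p : seq T) : seq {set T} := pairmap (fun u w => [set u; w]) x p.

Lemma alt_mem (X : eqType) c (l : seq X) : {subset alt c l <= l}.
Proof.
elim: l c => //= x l IH [] z; last by move/IH; rewrite inE => ->; rewrite orbT.
by rewrite !inE => /orP[->//|/IH ->]; rewrite orbT.
Qed.

Lemma wedges_in x p : path e x p -> edges_in e (wedges x p).
Proof. by elim: p x => //= z p IH x /andP[exz /IH->]; rewrite mem_gedge. Qed.

Lemma alt_in c l : edges_in e l -> edges_in e (alt c l).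
Proof. by move/allP => H; apply/allP => E /alt_mem /H. Qed.

(** An inner vertex of the walk lies between two consecutive edges, exactly one of which is
    selected; only the contribution of the two ends depends on [c] and on parity. *)
Lemma ldg_alt c x s z v : path e x (rcons s z) ->
  ldg (alt c (wedges x (rcons s z))) v =
  c * (v == x) + count_mem v s + (c (+) odd (size s)) * (v == z).
Proof.
have two u w : e u w -> ((v \in [set u; w]) : nat) = (v == u) + (v == w).
  move=> euw; rewrite !inE; case: eqVneq => [vu|_]; case: eqVneq => [vw|_] //.
  by rewrite -vu vw e_irr in euw.
elim: s c x => [|w s IH] c x /= /andP[exz pz].
  by case: c => //=; rewrite two // !mul1n !addn0.
have := IH (~~ c) w pz; case: c => /= H.
  rewrite -[LHS]/((v \in [set x; w]) + _) H two // (eq_sym w v) negbK.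
  by case: (odd _); rewrite !(mul0n, mul1n, add0n, addn0, addnA).
by rewrite H (eq_sym w v); case: (odd _); rewrite !(mul0n, mul1n, add0n, addn0, addnA).
Qed.

(* On a closed walk of odd length, [c = true] selects both edges at [y]. *)
Definition walk_alt c y (s : seq T) := alt c (wedges y (rcons s y)).

Lemma walk_alt_in S c y s : oddwalk e S (y :: s) -> edges_in e (walk_alt c y s).
Proof.
rewrite oddwalk_cons => /andP[p _]; apply/alt_in/wedges_in.
by apply: sub_path p; apply: induced_e.
Qed.

Lemma ldg_walk_alt S c y s v : oddwalk e S (y :: s) ->
  ldg (walk_alt c y s) v = count_mem v s + 2 * (c && (v == y)).
Proof.
rewrite oddwalk_cons => /andP[p os]; rewrite ldg_alt; last first.
  by apply: sub_path p; apply: induced_e.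
by rewrite (negPf os); case: c; case: (v == y) => //=; lia.
Qed.

Section ChordlessWeights.
Variables (s : seq T) (y : T) (a b : seq {set T}).
Hypotheses (cs : chordless_cycle_seq e s) (os : odd (size s)) (ys : y \in s).
Hypotheses (ain : edges_in e a) (bin : edges_in e b).
Hypotheses (asupp : forall v, v \notin s -> ldg a v = 0).
Hypotheses (bsupp : forall v, v \notin s -> ldg b v = 0).
Hypothesis bal : forall v, v != y -> ldg a v = ldg b v.

(** As [s] is chordless, [a] and [b] only use edges of the cycle, so these weights determine the
    pair up to common edges. Balance at a vertex other than [y] makes consecutive weights
    opposite. *)
Let w v : rat := cdiff (a, b) [set v; next s v].

Let us : uniq s. Proof. by case/and4P: cs. Qed.

Lemma set2_inj (x z z' : T) : [set x; z] = [set x; z'] -> z = z'.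
Proof.
move=> E; have : z \in [set x; z'] by rewrite -E set22.
have : z' \in [set x; z] by rewrite E set22.
by rewrite !inE => /orP[] /eqP-> /orP[] /eqP.
Qed.

Lemma supported_edge c E : edges_in e c -> (forall v, v \notin s -> ldg c v = 0) ->
  E \in c -> exists2 v, v \in s & E = [set v; next s v].
Proof.
move=> /allP cin csupp Ec; have /gedgeP[x [z [exz EE]]] := cin _ Ec.
have ins v : v \in E -> v \in s.
  move=> vE; apply: contraT => /csupp /eqP; rewrite -leqn0 leqNgt -has_count.
  by case/negP; apply/hasP; exists E.
have xs : x \in s by apply: ins; rewrite EE set21.
have zs : z \in s by apply: ins; rewrite EE set22.
case/and4P: cs => _ _ _ /allP/(_ _ xs)/allP/(_ _ zs)/implyP/(_ exz)/orP[] /eqP E'.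
  by exists x => //; rewrite -E'.
by exists z => //; rewrite -E' setUC.
Qed.

Lemma next_neq_prev v : v \in s -> next s v != prev s v.
Proof.
move=> vs; have [i s' Es] := rot_to vs.
rewrite -(next_rot i us) -(prev_rot i us) Es.
have := us; rewrite -(rot_uniq i) Es; have : 2 < size (rot i s).
  by rewrite size_rot; case/and4P: cs.
rewrite Es; case: s' {Es} => [|c1 s'] //; case/lastP: s' => // s' c2 _ u'.
have -> : prev [:: v, c1 & rcons s' c2] v = c2.
  by rewrite -(prev_rotr 1 u') -!rcons_cons rotr1_rcons /= eqxx.
rewrite /= eqxx; case/and3P: u' => _.
by rewrite mem_rcons inE negb_or => /andP[].
Qed.

Lemma ldg_cycle c v : edges_in e c -> (forall v, v \notin s -> ldg c v = 0) -> v \in s ->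
  ldg c v = count_mem [set v; next s v] c + count_mem [set prev s v; v] c.
Proof.
move=> cin csupp vs; pose E1 := [set v; next s v]; pose E2 := [set prev s v; v].
have E12 : E1 != E2.
  by apply: contra (next_neq_prev vs) => /eqP; rewrite /E2 setUC => /set2_inj ->.
rewrite -count_predUI [X in _ + X](_ : _ = 0) ?addn0; last first.
  apply/eqP; rewrite -leqn0 leqNgt -has_count; apply/hasPn => E _ /=.
  by apply/negP => /andP[/eqP-> ]; apply/negP.
apply: eq_in_count => E Ec /=; have [x xs EE] := supported_edge cin csupp Ec.
apply/idP/orP => [|[] /eqP->]; rewrite ?set21 ?set22 //.
rewrite EE !inE => /orP[] /eqP->; first by left.
by right; rewrite prev_next.
Qed.

Lemma imbalance v : v \in s ->
  (((ldg a v)%:R - (ldg b v)%:R)%R : rat) = (w v + w (prev s v))%R.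
Proof.
move=> vs; rewrite !ldg_cycle // /w /cdiff /= next_prev // !natrD; ring.
Qed.

Lemma weight_step v : v \in s -> v != y -> w v = (- w (prev s v))%R.
Proof.
move=> vs vy; have := imbalance vs; rewrite bal // subrr => /esym/eqP.
by rewrite addr_eq0 => /eqP.
Qed.

Lemma weight_path x p : fpath (next s) x p -> x \in s -> y \notin p ->
  w (last x p) = ((-1) ^+ size p * w x)%R /\
  forall v, v \in p -> w v = w x \/ w v = (- w x)%R.
Proof.
elim: p x => [|z p IH] x /=; first by rewrite expr0 mul1r.
case/andP=> /eqP <- fp xs; rewrite inE negb_or => /andP[ny yp].
have ns : next s x \in s by rewrite mem_next.
have wn : w (next s x) = (- w x)%R by rewrite weight_step 1?eq_sym // prev_next.
have [wl wp] := IH _ fp ns yp; split; first by rewrite wl wn exprS; ring.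
move=> v; rewrite inE => /predU1P[->|/wp]; first by right.
by rewrite wn opprK => -[]; [right|left].
Qed.

(** Going around the odd cycle from [y] to its predecessor changes sign an even number of times, so
    the two edges at [y] carry the same weight and add up. *)
Lemma weights : (((ldg a y)%:R - (ldg b y)%:R)%R : rat) = (2%:R * w y)%R /\
  forall v, v \in s -> w v = w y \/ w v = (- w y)%R.
Proof.
have [i s' Es] := rot_to ys.
have us' : uniq (y :: s') by rewrite -Es rot_uniq.
have fc : fcycle (next s) (y :: s') by rewrite -Es rot_cycle cycle_next.
have fp : fpath (next s) y s' by move: fc; rewrite /= rcons_path => /andP[].
have last_next : next s (last y s') = y.
  by move: fc; rewrite /= rcons_path => /andP[_ /eqP].
have ys' : y \notin s' by case/andP: us'.
have [wl wp] := weight_path fp ys ys'.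
have es : odd (size s') = false.
  by apply/negbTE; move: os; rewrite -(size_rot i) Es.
split.
  rewrite imbalance // -{2}last_next prev_next // wl -signr_odd es expr0; ring.
move=> v; rewrite -(mem_rot i) Es inE => /predU1P[->|/wp //]; by left.
Qed.

Lemma imbalanced_weights v : ldg a y != ldg b y -> v \in s -> w v <> 0%R.
Proof.
move=> neq vs; have [Ey /(_ _ vs) H] := weights => w0.
have wy : w y = 0%R by case: H; rewrite w0 // => /eqP; rewrite eq_sym oppr_eq0 => /eqP.
move: Ey; rewrite wy mulr0 => /eqP; rewrite subr_eq0 eqr_nat.
exact/negP.
Qed.

Lemma balanced_weights : ldg a y = ldg b y -> forall E, cdiff (a, b) E = 0%R.
Proof.
move=> eqy E; have [Ey H] := weights.
have wy : w y = 0%R.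
  by move: Ey; rewrite eqy subrr => /esym/eqP; rewrite mulf_eq0 => /orP[//|/eqP].
have w0 v : v \in s -> w v = 0%R by move/H; rewrite wy oppr0 => -[].
have [Ea|Ea] := boolP (E \in a).
  by have [v vs ->] := supported_edge ain asupp Ea; apply: w0.
have [Eb|Eb] := boolP (E \in b).
  by have [v vs ->] := supported_edge bin bsupp Eb; apply: w0.
by rewrite /cdiff /= (count_memPn Ea) (count_memPn Eb) subrr.
Qed.

End ChordlessWeights.
End EdgeLists.

(** * Generators straddling the cut vertex *)

Section Straddle.
Variables (T : finType) (e : rel T).
Hypotheses (e_sym : symmetric e) (e_irr : irreflexive e).
Implicit Types (S : {set T}) (E : {set T}) (a b : seq {set T}) (x z v : T).

Variables (k : nat) (u : 'I_k -> seq {set T} * seq {set T}).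
Hypothesis u_in : forall i, edges_in e (u i).1 /\ edges_in e (u i).2.
Hypothesis u_dg : forall i v, ldg (u i).1 v = ldg (u i).2 v.
Hypothesis u_free : forall c : 'I_k -> rat,
  (forall E, \sum_i c i * cdiff (u i) E = 0)%R -> forall i, c i = 0%R.
Hypothesis u_span : forall a b, edges_in e a -> edges_in e b -> ldg a =1 ldg b ->
  exists2 c : 'I_k -> rat,
    forall E, (cdiff (a, b) E = \sum_i c i * cdiff (u i) E)%R
  & forall i, c i != 0%R -> forall v, ldg (u i).1 v <= ldg a v.

(* [H] is one side of the cut vertex [y]: every edge lies in [H] or in
   [y |: ~: H]. *)
Variables (y : T) (H : {set T}).
Hypothesis yH : y \in H.
Hypothesis Hside : forall x z, e x z -> x \in H -> z \notin H -> x = y.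

Definition part a := [seq E : {set T} <- a | E \subset H].
Definition copart a := [seq E : {set T} <- a | ~~ (E \subset H)].

Lemma part_in a : edges_in e a -> edges_in e (part a).
Proof. by move/allP=> ain; apply/allP => E; rewrite mem_filter => /andP[_ /ain]. Qed.

Lemma copart_in a : edges_in e a -> edges_in e (copart a).
Proof. by move/allP=> ain; apply/allP => E; rewrite mem_filter => /andP[_ /ain]. Qed.

Lemma ldg_part_out a v : v \notin H -> ldg (part a) v = 0.
Proof.
move=> vH; apply/eqP; rewrite -leqn0 leqNgt -has_count; apply/hasPn => E.
rewrite mem_filter => /andP[/subsetP sub _]; by apply: contra vH => /sub.
Qed.

Lemma ldg_copart_in a v : edges_in e a -> v \in H -> v != y -> ldg (copart a) v = 0.
Proof.
move=> /allP ain vH vy; apply/eqP; rewrite -leqn0 leqNgt -has_count.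
apply/hasPn => E; rewrite mem_filter => /andP[nsub /ain Ein].
apply/negP => vE; have [w evw EE] := gedge_at e_sym Ein vE.
case/negP: nsub; rewrite EE; apply/subsetP => x; rewrite !inE => /orP[] /eqP-> //.
by apply: contraT => wH; rewrite (Hside evw vH wH) eqxx in vy.
Qed.

Lemma ldg_split a v : ldg a v = ldg (part a) v + ldg (copart a) v.
Proof.
rewrite -ldg_cat; apply/esym/permP.
by rewrite /part /copart (perm_filterC (fun E : {set T} => E \subset H)).
Qed.

Lemma cdiff_split a b E :
  cdiff (a, b) E = (cdiff (part a, part b) E + cdiff (copart a, copart b) E)%R.
Proof.
rewrite -cdiff_cat; suff H' c : count_mem E c = count_mem E (part c ++ copart c).
  by rewrite /cdiff /= -!H'.
apply/esym/permP; by rewrite /part /copart (perm_filterC (fun E : {set T} => E \subset H)).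
Qed.

Definition straddles (w : seq {set T} * seq {set T}) :=
  ldg (part w.1) y != ldg (part w.2) y.

Lemma part_id a : (forall v, v \notin H -> ldg a v = 0) -> part a = a.
Proof.
move=> aH; apply/all_filterP/allP => E Ea; apply/subsetP => v vE.
apply: contraT => /aH /eqP; rewrite -leqn0 leqNgt -has_count => /hasPn/(_ _ Ea).
by rewrite vE.
Qed.

Lemma part_nil a : edges_in e a -> (forall v, v \in H -> v != y -> ldg a v = 0) ->
  part a = [::].
Proof.
move=> /allP ain aH; apply/eqP; rewrite -[_ == _]negbK -has_filter; apply/hasPn => E Ea.
apply/negP => /subsetP sub; have /gedgeP[x [z [exz EE]]] := ain _ Ea.
have hy v : v \in E -> v = y.
  move=> vE; apply/eqP; apply: contraT => vy.
  have /eqP := aH v (sub _ vE) vy; rewrite -leqn0 leqNgt -has_count => /hasPn/(_ _ Ea).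
  by rewrite vE.
have xy : x = y by apply: hy; rewrite EE set21.
have zy : z = y by apply: hy; rewrite EE set22.
by move: exz; rewrite xy zy e_irr.
Qed.

Lemma inside_not_straddles i :
  (forall v, v \notin H -> ldg (u i).1 v = 0) -> ~~ straddles (u i).
Proof.
move=> uH; have uH2 v : v \notin H -> ldg (u i).2 v = 0 by rewrite -u_dg; apply: uH.
by rewrite /straddles !part_id // u_dg eqxx.
Qed.

Lemma outside_not_straddles i :
  (forall v, v \in H -> v != y -> ldg (u i).1 v = 0) -> ~~ straddles (u i).
Proof.
move=> uH; have [in1 in2] := u_in i.
have uH2 v : v \in H -> v != y -> ldg (u i).2 v = 0 by rewrite -u_dg; apply: uH.
by rewrite /straddles !part_nil ?eqxx.
Qed.

(** A pair that does not straddle restricts to a relation on each side. Expanding these separately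
    uses only generators whose degree lies on one side, and such generators do not straddle. *)
Lemma balanced_span a b : edges_in e a -> edges_in e b -> ldg a =1 ldg b ->
  ~~ straddles (a, b) ->
  exists2 c : 'I_k -> rat,
    forall E, (cdiff (a, b) E = \sum_i c i * cdiff (u i) E)%R
  & forall i, straddles (u i) -> c i = 0%R.
Proof.
move=> ain bin ab; rewrite /straddles negbK /= => /eqP py.
have p_eq : ldg (part a) =1 ldg (part b).
  move=> v; have [->//|vy] := eqVneq v y.
  have [vH|vH] := boolP (v \in H); last by rewrite !ldg_part_out.
  by have := ab v; rewrite (ldg_split a) (ldg_split b) !ldg_copart_in // !addn0.
have c_eq : ldg (copart a) =1 ldg (copart b).
  by move=> v; have := ab v; rewrite (ldg_split a) (ldg_split b) p_eq => /addnI.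
have [c1 c1E c1d] := u_span (part_in ain) (part_in bin) p_eq.
have [c2 c2E c2d] := u_span (copart_in ain) (copart_in bin) c_eq.
exists (fun i => c1 i + c2 i)%R => [E|i str].
  by rewrite cdiff_split c1E c2E -big_split; apply: eq_bigr => i _; rewrite mulrDl.
have -> : c1 i = 0%R.
  apply/eqP; apply: contraT => /c1d le; suff /negP : ~~ straddles (u i) by case.
  apply: inside_not_straddles => v /(ldg_part_out a) E; by apply/eqP; rewrite -leqn0 -E.
have -> : c2 i = 0%R; last by rewrite addr0.
apply/eqP; apply: contraT => /c2d le; suff /negP : ~~ straddles (u i) by case.
apply: outside_not_straddles => v vH vy; by apply/eqP; rewrite -leqn0 -(ldg_copart_in ain vH vy).
Qed.

Definition mult n a := flatten (nseq n a).

Lemma count_mult (P : pred {set T}) n a : count P (mult n a) = n * count P a.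
Proof. by rewrite /mult count_flatten map_nseq sumn_nseq mulnC. Qed.

Lemma mult_in n a : edges_in e a -> edges_in e (mult n a).
Proof.
by move/allP=> ain; apply/allP => E /flattenP[_ /nseqP[-> _] /ain].
Qed.

(** Combining two such generators so that their imbalances at [y] cancel gives a relation that
    [balanced_span] writes without either of them, contradicting freeness. *)
Lemma straddles_unique i j : straddles (u i) -> straddles (u j) -> i = j.
Proof.
move=> si sj; apply/eqP; apply: contraT => ij.
pose phi a := ldg (part a) y.
have phiE a : phi a = count (fun E => (y \in E) && (E \subset H)) a.
  by rewrite /phi /ldg /part count_filter.
have phi_mult n a : phi (mult n a) = n * phi a by rewrite !phiE count_mult.
have phi_cat a b : phi (a ++ b) = phi a + phi b by rewrite !phiE count_cat.
have [i1 i2] := u_in i; have [j1 j2] := u_in j.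
set p := phi (u i).1; set q := phi (u i).2; set r := phi (u j).1; set t := phi (u j).2.
(* The pair stands for [(r - t) u_i - (p - q) u_j]; negative terms are moved to the other side. *)
pose a := mult r (u i).1 ++ mult t (u i).2 ++ mult p (u j).2 ++ mult q (u j).1.
pose b := mult r (u i).2 ++ mult t (u i).1 ++ mult p (u j).1 ++ mult q (u j).2.
have ain : edges_in e a by rewrite !edges_in_cat !mult_in.
have bin : edges_in e b by rewrite !edges_in_cat !mult_in.
have ab : ldg a =1 ldg b.
  by move=> v; rewrite !ldg_cat /ldg !count_mult -!/(ldg _ v) !u_dg.
have nstr : ~~ straddles (a, b).
  rewrite /straddles /= -/(phi a) -/(phi b) /a /b !phi_cat !phi_mult -/p -/q -/r -/t.
  by rewrite negbK; apply/eqP; ring.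
have [c cE c0] := balanced_span ain bin ab nstr.
have abE E : cdiff (a, b) E = ((r%:R - t%:R) * cdiff (u i) E - (p%:R - q%:R) * cdiff (u j) E)%R.
  by rewrite /cdiff /= /a /b !count_cat !count_mult !natrD !natrM; ring.
(* Difference of the two expansions of the pair. Its coefficient at [i] is [t - r], whose vanishing
   would keep [u j] from straddling. *)
pose d l : rat := (c l - (l == i)%:R * (r%:R - t%:R) + (l == j)%:R * (p%:R - q%:R))%R.
have d0 : d i = 0%R.
  apply: u_free => E.
  rewrite (eq_bigr (fun l => c l * cdiff (u l) E - (l == i)%:R * ((r%:R - t%:R) * cdiff (u l) E)
     + (l == j)%:R * ((p%:R - q%:R) * cdiff (u l) E)))%R; last by move=> l _; rewrite /d; ring.
  rewrite big_split sumrB /= -cE abE.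
  have pick l0 (F : 'I_k -> rat) : (\sum_l (l == l0)%:R * F l = F l0)%R.
    rewrite (bigD1 l0) //= eqxx mul1r big1 ?addr0 // => l /negPf ->.
    by rewrite mul0r.
  by rewrite !pick; ring.
move: d0; rewrite /d c0 // eqxx (negPf ij) mul1r mul0r addr0 sub0r => /eqP.
by rewrite oppr_eq0 subr_eq0 eqr_nat => /eqP E; move: sj; rewrite /straddles -/(phi _) -/r E eqxx.
Qed.

(** The imbalance at [y] within [H] is linear in [cdiff], so some generator occurring in the
    expansion has a nonzero one. *)
Lemma straddles_below a b : edges_in e a -> edges_in e b -> ldg a =1 ldg b ->
  straddles (a, b) ->
  exists2 i, straddles (u i) & forall v, ldg (u i).1 v <= ldg a v.
Proof.
move=> ain bin ab str; have [c cE cd] := u_span ain bin ab.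
apply: contrapT => no; case/negP: str; apply/eqP => /=.
have phiE w : (((ldg (part w.1) y)%:R - (ldg (part w.2) y)%:R)%R : rat) =
    (\sum_(E : {set T} | (y \in E) && (E \subset H)) cdiff w E)%R.
  have cE' s : ldg (part s) y = \sum_(E : {set T} | (y \in E) && (E \subset H)) count_mem E s.
    by rewrite -count_sum_mem /ldg /part count_filter.
  by rewrite !cE' !natr_sum -sumrB.
apply/eqP; rewrite -(eqr_nat rat) -subr_eq0 -[X in X == _]/(_ - _)%R (phiE (a, b)).
under eq_bigr do rewrite cE.
rewrite exchange_big /= big1 // => i _; rewrite -mulr_sumr -phiE.
have [->|ci] := eqVneq (c i) 0%R; first by rewrite mul0r.
have : ~~ straddles (u i) by apply/negP => si; apply: no; exists i => //; apply: cd.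
by rewrite negbK => /eqP ->; rewrite subrr mulr0.
Qed.

(* [a], [b] is the part inside [H] of the unique generator straddling the cut
   vertex; its degree bounds from below the degree of every straddling pair. *)
Lemma minimal_straddle s0 t : oddwalk e H (y :: s0) -> y \notin s0 ->
  oddwalk e (y |: ~: H) (y :: t) -> y \notin t ->
  exists a b, [/\ edges_in e a, edges_in e b,
      ldg a y = 2 /\ ldg b y = 0, forall v, v != y -> ldg a v = ldg b v
    & forall s, oddwalk e H (y :: s) -> y \notin s ->
        forall v, v != y -> ldg a v <= count_mem v s].
Proof.
move=> ws0 ys0 wt yt.
have below s : oddwalk e H (y :: s) -> y \notin s ->
    exists2 i, straddles (u i) &
      (forall v, v != y -> v \in H -> ldg (u i).1 v <= count_mem v s) /\ ldg (u i).1 y <= 2.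
  move=> ws ys.
  (* Opposite alternations on the two walks: both lists have degree 2 at [y], coming from [H] in [a]
     and from the other side in [b]. *)
  pose a := walk_alt true y s ++ walk_alt false y t.
  pose b := walk_alt false y s ++ walk_alt true y t.
  have ain : edges_in e a by rewrite edges_in_cat (walk_alt_in _ ws) (walk_alt_in _ wt).
  have bin : edges_in e b by rewrite edges_in_cat (walk_alt_in _ ws) (walk_alt_in _ wt).
  have dga v : ldg a v = count_mem v s + count_mem v t + 2 * (v == y).
    by rewrite ldg_cat (ldg_walk_alt e_irr _ _ ws) (ldg_walk_alt e_irr _ _ wt) /= addn0 addnAC.
  have dgb v : ldg b v = count_mem v s + count_mem v t + 2 * (v == y).
    by rewrite ldg_cat (ldg_walk_alt e_irr _ _ ws) (ldg_walk_alt e_irr _ _ wt) /= addn0 addnA.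
  have sH c : part (walk_alt c y s) = walk_alt c y s.
    apply: part_id => v vH; rewrite (ldg_walk_alt e_irr _ _ ws).
    have vy : (v == y) = false by apply: contraNF vH => /eqP->.
    rewrite vy andbF addn0; apply/count_memPn; apply: contra vH => vs.
    by apply: (oddwalk_subset ws); rewrite inE vs orbT.
  have tt v : v \in H -> v != y -> v \notin t.
    move=> vH vy; apply/negP => vt.
    have : v \in y |: ~: H by apply: (oddwalk_subset wt); rewrite inE vt orbT.
    by rewrite !inE (negPf vy) vH.
  have tH c : part (walk_alt c y t) = [::].
    apply: part_nil => [|v vH vy]; first exact: walk_alt_in wt.
    rewrite (ldg_walk_alt e_irr _ _ wt) (negPf vy) andbF addn0.
    by apply/count_memPn/tt.
  have ab : ldg a =1 ldg b by move=> v; rewrite dga dgb.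
  have str : straddles (a, b).
    rewrite /straddles /= /part !filter_cat -!/(part _) !sH !tH !cats0.
    by rewrite !(ldg_walk_alt e_irr _ _ ws) eqxx /= (count_memPn ys).
  have [i si le] := straddles_below ain bin ab str; exists i => //; split.
    move=> v vy vH; apply: leq_trans (le v) _.
    by rewrite dga (negPf vy) (count_memPn (tt _ vH vy)) !addn0.
  by apply: leq_trans (le y) _; rewrite dga (count_memPn ys) (count_memPn yt) eqxx.
have [i si [_ iy]] := below _ ws0 ys0.
have [in1 in2] := u_in i.
have p_eq v : v != y -> ldg (part (u i).1) v = ldg (part (u i).2) v.
  move=> vy; have [vH|vH] := boolP (v \in H); last by rewrite !ldg_part_out.
  by have := u_dg i v; rewrite (ldg_split (u i).1) (ldg_split (u i).2) !ldg_copart_in // !addn0.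
have bound s : oddwalk e H (y :: s) -> y \notin s ->
    forall v, v != y -> ldg (part (u i).1) v <= count_mem v s.
  (* The straddling generators found below different walks coincide by [straddles_unique], so a
     single one is below all walks. *)
  move=> ws ys v vy; have [j sj [jle _]] := below _ ws ys.
  have [vH|vH] := boolP (v \in H); last by rewrite ldg_part_out.
  apply: leq_trans (jle v vy vH); rewrite (straddles_unique si sj).
  by rewrite (ldg_split (u j).1) leq_addr.
have iy2 : ldg (u i).2 y <= 2 by rewrite -u_dg.
have l1 : ldg (part (u i).1) y <= 2 by apply: leq_trans iy; rewrite (ldg_split (u i).1) leq_addr.
have l2 : ldg (part (u i).2) y <= 2 by apply: leq_trans iy2; rewrite (ldg_split (u i).2) leq_addr.
(* The degrees of a list of edges have even sum, and the two parts agree away from [y]. *)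
have par : odd (ldg (part (u i).1) y) = odd (ldg (part (u i).2) y).
  have := sum_ldg e_irr (part_in in1); have := sum_ldg e_irr (part_in in2).
  rewrite (bigD1 y) //= => E2; rewrite (bigD1 y) //= (eq_bigr _ p_eq) => E1.
  move: E1 E2; move: (\sum_(_ | _) _) (ldg _ _) (ldg _ _) (size _) (size _); clear; lia.
(* Unequal numbers of equal parity, at most 2, are 0 and 2; if needed the two lists are
   exchanged. *)
have [[e1 e2]|[e1 e2]] :
    (ldg (part (u i).1) y = 2 /\ ldg (part (u i).2) y = 0) \/
    (ldg (part (u i).1) y = 0 /\ ldg (part (u i).2) y = 2).
- move: si l1 l2 par; rewrite /straddles.
  by case: (ldg _ _) => [|[|[|?]]]; case: (ldg _ _) => [|[|[|?]]] //=; auto.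
- by exists (part (u i).1), (part (u i).2); split=> //; apply: part_in.
exists (part (u i).2), (part (u i).1); split; rewrite ?part_in //.
  by move=> v /p_eq.
by move=> s ws ys v vy; rewrite -p_eq //; apply: bound ws ys v vy.
Qed.

End Straddle.

(** * Walks in a biconnected set *)

Section Blocks.
Variables (T : finType) (e : rel T).
Hypotheses (e_sym : symmetric e) (e_irr : irreflexive e).
Implicit Types (S B C : {set T}) (x y z v : T) (s : seq T).

Lemma connected_in_D1 B v : biconnected e B -> connected_in e (B :\ v).
Proof.
case/and3P=> _ cB /forall_inP cBv; have [/cBv//|vB] := boolP (v \in B).
by have /setDidPl -> : [disjoint B & [set v]] by rewrite disjoint_sym disjoints1.
Qed.

Lemma connected_path S x z : connected_in e S -> x \in S -> z \in S ->
  exists p, [/\ path (induced e S) x p, uniq (x :: p) & last x p = z].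
Proof.
move=> /forall_inP/(_ x) H xS zS; have /forall_inP/(_ _ zS)/connectP[p pp ->] := H xS.
by case/shortenP: pp => p' pp' up' _; exists p'.
Qed.

Lemma chordless_oddwalk B s : chordless_cycle_seq e s -> odd (size s) ->
  {subset s <= B} -> oddwalk e B s.
Proof.
move=> /and4P[_ _ cs _] os sB; rewrite /oddwalk os andbT.
case: s cs os sB => //= x s px _ sB; apply: path_inducedI => //.
  by apply: sB; rewrite inE eqxx.
by move=> z; rewrite mem_rcons => /sB.
Qed.

(** The connecting path is traversed twice, so the parity of [p :: c] is kept. *)
Lemma oddwalk_attach S y q p c : path (induced e S) y (rcons q p) ->
  oddwalk e S (p :: c) -> oddwalk e S (y :: rcons q p ++ rcons c p ++ rev q).
Proof.
move=> pq /andP[pc oc].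
rewrite oddwalk_cons !rcons_cat !cat_path !last_rcons pq -[path _ p _]/(cycle _ (p :: c)) pc /=.
have := path_rev e_sym pq; rewrite last_rcons belast_rcons rev_cons => -> /=.
rewrite !size_cat !size_rcons size_rev; move: oc => /=.
by rewrite !oddD /=; case: (odd (size c)); case: (odd (size q)).
Qed.

(** If [y] is off [s], biconnectedness gives a path avoiding [v] from [y] to a point of [s] other
    than [v]; going along it, around [s] and back meets [v] only on [s]. *)
Lemma odd_walk_avoiding B y s v : biconnected e B -> y \in B -> oddwalk e B s ->
  uniq s -> 1 < size s -> v != y ->
  exists w, [/\ oddwalk e B (y :: w), y \notin w & count_mem v w <= (v \in s)].
Proof.
move=> biB yB ws us s1 vy.
have [ys|ys] := boolP (y \in s).
  have [i w Es] := rot_to ys; exists w.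
  have := us; rewrite -(rot_uniq i) Es /= => /andP[yw uw]; split=> //.
    by rewrite -Es oddwalk_rot.
  by rewrite count_uniq_mem // -(mem_rot i s) Es inE (negPf vy).
have [p ps pv] : exists2 p, p \in s & p != v.
  case: s us s1 {ws ys} => [|p1 [|p2 s]] //=; rewrite inE negb_or -andbA.
  case/and3P=> p12 _ _ _; have [Ev|p1v] := eqVneq p1 v; last by exists p1; rewrite ?inE ?eqxx.
  by exists p2; rewrite ?inE ?eqxx ?orbT // -Ev eq_sym.
have pB : p \in B :\ v by rewrite !inE pv (oddwalk_subset ws).
have yBv : y \in B :\ v by rewrite !inE eq_sym vy.
have [q [pq uq lq]] := connected_path (connected_in_D1 v biB) yBv pB.
have {}pq' : path (induced e B) y q.
  by apply: sub_path pq; apply: induced_sub; rewrite subD1set.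
have qv : v \notin q.
  by apply/negP => /(path_induced_mem pq); rewrite !inE eqxx.
case/lastP: q => [|q p'] in uq pq lq pq' qv *.
  by move: lq ps ys => /= <- ->.
move: lq; rewrite last_rcons => E; subst p'.
have [i c Es] := rot_to ps.
have wc : oddwalk e B (p :: c) by rewrite -Es oddwalk_rot.
have sc x : x \in p :: c -> x \in s by rewrite -Es mem_rot.
exists (rcons q p ++ rcons c p ++ rev q); split.
- exact: oddwalk_attach.
- have yq : y \notin rcons q p by case/andP: uq.
  rewrite !mem_cat !negb_or mem_rev yq /=; apply/andP; split.
    by apply: contra ys; rewrite mem_rcons => /sc.
  by apply: contra yq; rewrite mem_rcons inE => ->; rewrite orbT.
have q0 : v \notin q by apply: contra qv; rewrite mem_rcons inE => ->; rewrite orbT.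
rewrite !count_cat (count_memPn qv) count_rev (count_memPn q0) addn0 add0n.
have -> : count_mem v (rcons c p) = count_mem v (p :: c) by rewrite -cats1 count_cat addnC /= addn0.
by rewrite count_uniq_mem -?Es ?rot_uniq // mem_rot.
Qed.

End Blocks.

(** * Odd chordless cycles of a block, seen from the straddling pair *)

Section Half.
Variables (T : finType) (e : rel T).
Hypotheses (e_sym : symmetric e) (e_irr : irreflexive e).
Implicit Types (S C : {set T}) (E : {set T}) (x z v : T) (s : seq T).

Variables (k : nat) (u : 'I_k -> seq {set T} * seq {set T}).
Hypothesis u_in : forall i, edges_in e (u i).1 /\ edges_in e (u i).2.
Hypothesis u_dg : forall i v, ldg (u i).1 v = ldg (u i).2 v.
Hypothesis u_free : forall c : 'I_k -> rat,
  (forall E, \sum_i c i * cdiff (u i) E = 0)%R -> forall i, c i = 0%R.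
Hypothesis u_span : forall a b, edges_in e a -> edges_in e b -> ldg a =1 ldg b ->
  exists2 c : 'I_k -> rat,
    forall E, (cdiff (a, b) E = \sum_i c i * cdiff (u i) E)%R
  & forall i, c i != 0%R -> forall v, ldg (u i).1 v <= ldg a v.

(** [a], [b] is the pair supplied by [minimal_straddle], with its minimality restricted to walks in
    [B]. *)
Variables (y : T) (a b : seq {set T}) (B : {set T}).
Hypotheses (yB : y \in B) (biB : biconnected e B).
Hypotheses (ain : edges_in e a) (bin : edges_in e b).
Hypotheses (ay : ldg a y = 2) (by0 : ldg b y = 0).
Hypothesis ab : forall v, v != y -> ldg a v = ldg b v.
Hypothesis amin : forall s, oddwalk e B (y :: s) -> y \notin s ->
  forall v, v != y -> ldg a v <= count_mem v s.

Lemma straddle_support s v : chordless_cycle_seq e s -> odd (size s) ->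
  {subset s <= B} -> v != y -> ldg a v <= (v \in s).
Proof.
move=> cs os sB vy; have ws := chordless_oddwalk cs os sB.
case/and4P: cs => us s2 _ _.
have [w [ww yw cw]] := odd_walk_avoiding e_sym biB yB ws us (ltnW s2) vy.
by apply: leq_trans cw; apply: amin.
Qed.

Lemma ldg_gt0 c E v : E \in c -> v \in E -> 0 < ldg c v.
Proof. by move=> Ec vE; rewrite -has_count; apply/hasP; exists E. Qed.

(** An edge of [a] at [y] has multiplicity one, since its other end has degree at most 1 in [a];
    degree 2 at [y] thus needs two different edges. *)
Lemma straddle_neighbours s : chordless_cycle_seq e s -> odd (size s) ->
  {subset s <= B} -> exists z1 z2, [/\ z1 != z2, e y z1, e y z2,
    0 < ldg a z1 & 0 < ldg a z2].
Proof.
move=> cs os sB.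
have nb E : E \in a -> y \in E -> exists z, [/\ e y z, 0 < ldg a z & E = [set y; z]].
  move=> Ea yE; have Ein := allP ain _ Ea; have [z eyz EE] := gedge_at e_sym Ein yE.
  by exists z; split=> //; apply: (ldg_gt0 Ea); rewrite EE set22.
have /hasP[E1 E1a yE1] : has (fun E : {set T} => y \in E) a by rewrite has_count -/(ldg a y) ay.
have [z1 [eyz1 az1 EE1]] := nb _ E1a yE1.
have z1y : z1 != y by apply: contraTneq eyz1 => ->; rewrite e_irr.
have le1 : count_mem E1 a <= 1.
  apply: (@leq_trans (ldg a z1)); last first.
    exact: leq_trans (straddle_support cs os sB z1y) (leq_b1 _).
  by apply: sub_count => E /= /eqP->; rewrite EE1 set22.
have /hasP[E2 E2a /andP[yE2 E21]] : has (fun E : {set T} => (y \in E) && (E != E1)) a.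
  apply: contraT => /hasPn no; have : ldg a y <= count_mem E1 a; last by rewrite ay ltnNge le1.
  rewrite /ldg (@eq_in_count _ _ (pred1 E1)) // => E Ea /=.
  by apply/idP/eqP => [yE|->//]; have := no _ Ea; rewrite yE /= negbK => /eqP.
have [z2 [eyz2 az2 EE2]] := nb _ E2a yE2.
exists z1, z2; split=> //; apply: contraNneq E21 => E; by rewrite EE2 EE1 E.
Qed.

(** Take a shortest odd cycle. If it misses [y], it contains two neighbours [z1], [z2] of [y]; of
    its arcs between them one has even length, hence at least 2, and replacing it by the path
    through [y] gives another shortest odd walk. *)
Lemma odd_chordless_through : ~ bipartite_in e B ->
  exists2 s, y \in s & [/\ chordless_cycle_seq e s, odd (size s) & {subset s <= B}].
Proof.
move=> nbB; have cB : connected_in e B by case/and3P: biB.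
have [s [ws cs smin]] := odd_chordless_in e_sym e_irr cB nbB.
have os : odd (size s) by case/andP: ws.
have sB := oddwalk_subset ws.
have [ys|ys] := boolP (y \in s); first by exists s.
have [z1 [z2 [z12 eyz1 eyz2 az1 az2]]] := straddle_neighbours cs os sB.
have ins z : e y z -> 0 < ldg a z -> z \in s.
  move=> eyz az; have zy : z != y by apply: contraTneq eyz => ->; rewrite e_irr.
  by have := leq_trans az (straddle_support cs os sB zy); case: (z \in s).
have z1s := ins _ eyz1 az1; have z2s := ins _ eyz2 az2.
have shorter d : oddwalk e B (y :: d) -> size (y :: d) <= size s ->
    exists2 s, y \in s & [/\ chordless_cycle_seq e s, odd (size s) & {subset s <= B}].
  move=> wd ds; exists (y :: d); first by rewrite inE eqxx.
  split; [|by case/andP: wd|exact: oddwalk_subset wd].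
  apply: (shortest_oddwalk_chordless e_sym e_irr wd) => s' ws'.
  by apply: leq_trans ds (smin _ ws').
have [i r Es] := rot_to z1s.
have z2r : z2 \in r by move: z2s; rewrite -(mem_rot i) Es inE eq_sym (negPf z12).
have wr : oddwalk e B (z1 :: r) by rewrite -Es oddwalk_rot.
have sr : size s = (size r).+1 by rewrite -(size_rot i) Es.
case/splitPr: z2r => s1 s2 in wr sr Es.
move: wr; rewrite oddwalk_cons rcons_cat cat_path size_cat /= addnS oddS negbK.
case/andP=> /and3P[p1 l1 p2] par.
rewrite size_cat /= in sr.
have z1B := sB _ z1s; have z2B := sB _ z2s.
have yz1 : induced e B y z1 by rewrite inducedE yB z1B.
have yz2 : induced e B y z2 by rewrite inducedE yB z2B.
(* [size s1] is odd exactly when the arc from [z1] to [z2] has an even number of edges. *)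
have [o1|e1] := boolP (odd (size s1)).
  have e2 : ~~ odd (size s2) by move: par; rewrite oddD o1.
  apply: (shorter (z2 :: rcons s2 z1)).
    rewrite oddwalk_cons /= yz2 rcons_path p2 last_rcons /= size_rcons /= negbK.
    by rewrite induced_sym // yz1 e2.
  by rewrite /= size_rcons sr; case: (size s1) o1 => //= n _; move: (size s2); clear; lia.
have o2 : odd (size s2) by move: par; rewrite oddD (negPf e1).
apply: (shorter (z1 :: rcons s1 z2)).
  rewrite oddwalk_cons /= yz1 !rcons_path p1 l1 last_rcons /= size_rcons /= negbK.
  by rewrite induced_sym // yz2 e1.
by rewrite /= size_rcons sr; case: (size s2) o2 => //= n _; move: (size s1); clear; lia.
Qed.

(** The pair is supported on the cycle and unbalanced at [y], so all weights are nonzero and every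
    vertex of the cycle other than [y] has positive degree in [a]. *)
Lemma odd_chordless_through_support s : chordless_cycle_seq e s -> odd (size s) ->
  {subset s <= B} -> y \in s -> forall v, (v \in s) = (v == y) || (0 < ldg a v).
Proof.
move=> cs os sB ys v; have [->//|vy /=] := eqVneq v y.
have supp x : x \notin s -> ldg a x = 0.
  move=> xs; have xy : x != y by apply: contraNneq xs => ->.
  by have := straddle_support cs os sB xy; rewrite (negPf xs) leqn0 => /eqP.
have suppb x : x \notin s -> ldg b x = 0.
  by move=> xs; rewrite -ab ?supp //; apply: contraNneq xs => ->.
apply/idP/idP => [vs|av]; last by apply: contraT => /supp E; rewrite E in av.
have neq : ldg a y != ldg b y by rewrite ay by0.
have := imbalanced_weights cs os ys ain bin supp suppb ab neq vs.
rewrite lt0n; apply: contra_notN => /eqP a0.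
have b0 : ldg b v = 0 by rewrite -ab.
have c0 c : ldg c v = 0 -> count_mem [set v; next s v] c = 0.
  move=> cv; apply/eqP; rewrite -leqn0 -cv; apply: sub_count => E /= /eqP->.
  exact: set21.
by rewrite /cdiff /= !c0 // subrr.
Qed.

(** A neighbour [z] of [y] lies on both cycles, and each cycle [t] yields a relation supported on
    [t] and [y]. Their difference does not involve [y]; by freeness each of its generators occurs in
    one of the two expansions, so it lives on a single odd chordless cycle, where no nonzero
    relation exists. *)
Lemma avoiding_cycles_subset s s' :
  chordless_cycle_seq e s -> odd (size s) -> {subset s <= B} -> y \notin s ->
  chordless_cycle_seq e s' -> odd (size s') -> {subset s' <= B} -> y \notin s' ->
  {subset s <= s'}.
Proof.
move=> cs os sB ys cs' os' sB' ys' v vs; apply: contraT => vs'.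
have [z [_ [_ eyz _ az _]]] := straddle_neighbours cs os sB.
have zy : z != y by apply: contraTneq eyz => ->; rewrite e_irr.
have yz : y != z by rewrite eq_sym.
have ins t : chordless_cycle_seq e t -> odd (size t) -> {subset t <= B} -> z \in t.
  move=> ct ot tB.
  by have := leq_trans az (straddle_support ct ot tB zy); case: (z \in t).
(* [2 yz - chi_t - (a - b)] for the alternating vector [chi_t] of [t] based at
   [z]: the terms at [y] do not depend on [t]. *)
have build t : chordless_cycle_seq e t -> odd (size t) -> {subset t <= B} -> y \notin t ->
    exists r, [/\ forall c, edges_in e (walk_alt c z r),
      forall c x, ldg (walk_alt c z r) x = (x \in t) - (x == z) + 2 * (c && (x == z)),
      ldg ([set y; z] :: [set y; z] :: walk_alt false z r ++ b) =1
        ldg (walk_alt true z r ++ a)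
    & forall x, x \notin t -> x != y ->
        ldg ([set y; z] :: [set y; z] :: walk_alt false z r ++ b) x = 0].
  move=> ct ot tB yt; have zt := ins _ ct ot tB; have [i r Et] := rot_to zt.
  have wr : oddwalk e B (z :: r) by rewrite -Et oddwalk_rot; apply: chordless_oddwalk.
  have ur : uniq (z :: r) by rewrite -Et rot_uniq; case/and4P: ct.
  have dr c x : ldg (walk_alt c z r) x = (x \in t) - (x == z) + 2 * (c && (x == z)).
    rewrite (ldg_walk_alt e_irr _ _ wr) -(mem_rot i t) Et inE; case/andP: ur => zr ur.
    rewrite count_uniq_mem //; case: eqVneq => [->|]; last by rewrite subn0.
    by rewrite (negPf zr).
  exists r; split=> //.
  - by move=> c; apply: walk_alt_in wr.
  - move=> x; rewrite -cat1s -(cat1s _ (_ ++ _)) !ldg_cat !dr /=.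
    rewrite /ldg /= -!/(ldg _ _) !inE !addn0; have [->|xy] := eqVneq x y.
      by rewrite (negPf yt) (negPf yz) ay by0.
    rewrite (ab xy); case: (x == z) => /=; move: (ldg _ _); case: (x \in t); clear; lia.
  move=> x xt xy; rewrite -cat1s -(cat1s _ (_ ++ _)) !ldg_cat !dr /=.
  have xz : x != z by apply: contraNneq xt => ->.
  have -> : ldg b x = 0.
    rewrite -ab //; apply/eqP; rewrite -leqn0; have := straddle_support ct ot tB xy.
    by rewrite (negPf xt).
  by rewrite /ldg /= !inE (negPf xy) (negPf xz) (negPf xt).
have [r [rin rdg req rsupp]] := build _ cs os sB ys.
have [r' [rin' rdg' req' rsupp']] := build _ cs' os' sB' ys'.
have zs := ins _ cs os sB; have zs' := ins _ cs' os' sB'.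
have yzin : [set y; z] \in gedges e by apply: mem_gedge.
set A1 := [set y; z] :: [set y; z] :: walk_alt false z r ++ b in req rsupp.
set A2 := [set y; z] :: [set y; z] :: walk_alt false z r' ++ b in req' rsupp'.
pose A3 := walk_alt true z r' ++ walk_alt false z r.
pose B3 := walk_alt false z r' ++ walk_alt true z r.
have A1in : edges_in e A1 by rewrite /A1 /= -/(edges_in e _) edges_in_cat yzin rin bin.
have A2in : edges_in e A2 by rewrite /A2 /= -/(edges_in e _) edges_in_cat yzin rin' bin.
have B1in : edges_in e (walk_alt true z r ++ a) by rewrite edges_in_cat rin ain.
have B2in : edges_in e (walk_alt true z r' ++ a) by rewrite edges_in_cat rin' ain.
have A3in : edges_in e A3 by rewrite edges_in_cat rin rin'.
have B3in : edges_in e B3 by rewrite edges_in_cat rin rin'.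
have eq3 : ldg A3 =1 ldg B3.
  by move=> x; rewrite !ldg_cat !rdg !rdg' /=; case: (x \in s); case: (x \in s'); case: (x == z).
have [x1 x1E x1d] := u_span A1in B1in req.
have [x2 x2E x2d] := u_span A2in B2in req'.
have [x3 x3E x3d] := u_span A3in B3in eq3.
(* The third relation is the first minus the second, so freeness gives the same for the
   coefficients. *)
have x0 i : (x1 i - x2 i - x3 i = 0)%R.
  move: i; apply: u_free => E.
  under eq_bigr do rewrite !mulrBl.
  rewrite !sumrB -x1E -x2E -x3E /cdiff /A1 /A2 /A3 /B3 /= !count_cat !natrD; ring.
(* As [v] is off [s'], this edge belongs to [s] alone and has nonzero weight in the difference. *)
pose E0 := [set v; next s v].
have E3 : cdiff (A3, B3) E0 <> 0%R.
  have c0 c : count_mem E0 (walk_alt c z r') = 0.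
    have vz : v != z by apply: contraNneq vs' => ->.
    apply/eqP; rewrite -leqn0 -(_ : ldg (walk_alt c z r') v = 0); last first.
      by rewrite rdg' (negPf vs') (negPf vz) andbF.
    by apply: sub_count => E /= /eqP->; apply: set21.
  rewrite cdiff_cat /cdiff /= !c0 subrr add0r -opprB => /eqP; rewrite oppr_eq0 => /eqP.
  apply: (imbalanced_weights (y := z) cs os zs (rin true) (rin false)) => //.
  - by move=> x xs; rewrite rdg (negPf xs) /= sub0n; case: eqVneq xs => // ->; rewrite zs.
  - by move=> x xs; rewrite rdg (negPf xs) /= sub0n.
  - by move=> x xz; rewrite !rdg (negPf xz).
  - by rewrite !rdg zs eqxx.
apply: contra_notT E3 => _; rewrite x3E big1 // => i _.
have [->|x3i] := eqVneq (x3 i) 0%R; first by rewrite mul0r.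
have z3 x : x \notin s -> x \notin s' -> ldg (u i).1 x = 0.
  move=> xs xs'; apply/eqP; rewrite -leqn0; apply: leq_trans (x3d _ x3i x) _.
  have xz : x != z by apply: contraNneq xs => ->.
  by rewrite ldg_cat rdg rdg' (negPf xs) (negPf xs') (negPf xz) !andbF.
(* A generator of the difference has degree 0 at [y], so it is supported on [s] if it occurs in the
   first expansion and on [s'] if it occurs in the second. *)
suff kill t : chordless_cycle_seq e t -> odd (size t) -> z \in t ->
    (forall x, x \notin t -> ldg (u i).1 x = 0) -> cdiff (u i) E0 = 0%R.
  suff -> : cdiff (u i) E0 = 0%R by rewrite mulr0.
  have y0 : ldg (u i).1 y = 0 by apply: z3.
  have [x1i|x1i] := eqVneq (x1 i) 0%R; last first.
    apply: (kill s) => // x xs; have [->//|xy] := eqVneq x y.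
    by apply/eqP; rewrite -leqn0; apply: leq_trans (x1d _ x1i x) _; rewrite rsupp.
  have x2i : x2 i != 0%R.
    by apply: contra x3i => /eqP x2i; rewrite -oppr_eq0 -(x0 i) x1i x2i subrr sub0r.
  apply: (kill s') => // x xs; have [->//|xy] := eqVneq x y.
  by apply/eqP; rewrite -leqn0; apply: leq_trans (x2d _ x2i x) _; rewrite rsupp'.
move=> ct ot zt usupp; have [i1 i2] := u_in i.
rewrite [u i]surjective_pairing; apply: (balanced_weights ct ot zt i1 i2 usupp) => //.
by move=> x; rewrite -u_dg; apply: usupp.
Qed.

End Half.

(** * Blocks on either side of a cut vertex *)

Section Separation.
Variables (T : finType) (e : rel T).
Hypotheses (e_sym : symmetric e) (e_irr : irreflexive e).
Implicit Types (S V B C : {set T}) (x y z v : T).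

Lemma connect_inducedS S S' x z : S \subset S' ->
  connect (induced e S) x z -> connect (induced e S') x z.
Proof.
by move=> sub; apply: connect_sub => {x z} x z xz; apply/connect1/(induced_sub sub).
Qed.

Lemma connect_induced_sym S x z :
  connect (induced e S) x z = connect (induced e S) z x.
Proof. exact: (sym_connect_sym (@induced_sym _ _ e_sym S)). Qed.

Lemma connected_in_hub S h :
  (forall w, w \in S -> connect (induced e S) h w) -> connected_in e S.
Proof.
move=> hub; apply/forall_inP => x xS; apply/forall_inP => z zS.
by apply: connect_trans (hub _ zS); rewrite connect_induced_sym; apply: hub.
Qed.

Lemma connected_inP S x z : connected_in e S -> x \in S -> z \in S ->
  connect (induced e S) x z.
Proof. by move=> /forall_inP H /H /forall_inP; apply. Qed.

Lemma path_connect_in S x q : path e x q -> {subset x :: q <= S} ->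
  connect (induced e S) x (last x q).
Proof.
move=> pq sub; apply/connectP; exists q => //; apply: path_inducedI => //.
  by apply: sub; rewrite inE eqxx.
by move=> w wq; apply: sub; rewrite inE wq orbT.
Qed.

(** [V] has at most one element, which treats connectedness and biconnectedness together. If [y] is
    removed, the path joins [B] to [C]; otherwise they meet at [y], and each remaining vertex of the
    path reaches one of its ends. *)
Lemma union_with_path_connected B C V x z y q :
  connected_in e (B :\: V) -> connected_in e (C :\: V) ->
  (forall v v', v \in V -> v' \in V -> v = v') ->
  y \in B -> y \in C -> x \in B -> z \in C -> y \notin x :: q ->
  path e x q -> uniq (x :: q) -> last x q = z ->
  connected_in e ((B :|: C :|: [set w in x :: q]) :\: V).
Proof.
move=> cB cC V1 yB yC xB zC yq pq uq lq; set S := B :|: C :|: _.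
have BS : B :\: V \subset S :\: V by apply: setSD; rewrite /S -setUA subsetUl.
have CS : C :\: V \subset S :\: V by apply: setSD; rewrite /S (setUC B) -setUA subsetUl.
have inS w : (w \in S) = [|| w \in B, w \in C | w \in x :: q].
  by rewrite /S !in_setU in_set orbA.
clearbody S.
have qS w : w \in x :: q -> w \in S by move=> wq; rewrite inS wq !orbT.
have conB w w' : w \in B :\: V -> w' \in B :\: V -> connect (induced e (S :\: V)) w w'.
  by move=> wB wB'; apply: connect_inducedS BS (connected_inP cB wB wB').
have conC w w' : w \in C :\: V -> w' \in C :\: V -> connect (induced e (S :\: V)) w w'.
  by move=> wC wC'; apply: connect_inducedS CS (connected_inP cC wC wC').
have [yV|yV] := boolP (y \in V).
  have qV w : w \in x :: q -> w \notin V.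
    by move=> wq; apply/negP => /(V1 _ _ yV) E; rewrite -E (negPf yq) in wq.
  have conQ w : w \in x :: q -> connect (induced e (S :\: V)) x w.
    move=> wq; case/splitPl: wq pq qV qS {uq lq yq inS} => q1 q2 <- pq qV qS.
    move: pq; rewrite cat_path => /andP[pq1 _]; apply: path_connect_in => // w' wq'.
    have {}wq' : w' \in x :: q1 ++ q2 by rewrite -cat_cons mem_cat wq'.
    by rewrite in_setD qV ?qS.
  have xV : x \notin V by apply: qV; rewrite inE eqxx.
  have zq : z \in x :: q by rewrite -lq mem_last.
  apply: (@connected_in_hub _ x) => w; rewrite in_setD => /andP[wV].
  rewrite inS => /or3P[wB|wC|/conQ//].
    by apply: conB; rewrite in_setD ?xV ?wV.
  have zV := qV _ zq; apply: connect_trans (conQ _ zq) (conC _ _ _ _).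
    by rewrite in_setD zV.
  by rewrite in_setD wV.
apply: (@connected_in_hub _ y) => w; rewrite in_setD => /andP[wV].
rewrite inS => /or3P[wB|wC|wq].
- by apply: conB; rewrite in_setD ?yV ?wV.
- by apply: conC; rewrite in_setD ?yV ?wV.
case/splitPl: wq pq uq lq qS {yq inS} => q1 q2 l1 pq uq lq qS.
move: pq; rewrite cat_path => /andP[pq1]; rewrite l1 => pq2.
(* A removed vertex before [w] leaves the way on to [z] free; otherwise the way back to [x] is
   free. *)
have [/hasP[v vq1 vV]|/hasPn q1V] := boolP (has (mem V) (x :: q1)).
  have q2V w' : w' \in w :: q2 -> w' \notin V.
    rewrite inE => /predU1P[->//|wq2]; apply/negP => /(V1 _ _ vV) E.
    move: uq; rewrite -cat_cons cat_uniq => /and3P[_ /hasPn/(_ _ wq2) + _].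
    by rewrite /= -E vq1.
  have lz : last w q2 = z by rewrite -lq last_cat l1.
  apply: (@connect_trans _ _ z).
    by apply: conC; rewrite in_setD ?yV // zC andbT q2V // -lz mem_last.
  rewrite connect_induced_sym -lz; apply: path_connect_in => // w' wq'.
  rewrite in_setD q2V // qS // -cat_cons mem_cat; move: wq'; rewrite inE.
  by case/predU1P=> [->|->]; rewrite ?orbT // -l1 mem_last.
apply: (@connect_trans _ _ x).
  by apply: conB; rewrite in_setD ?yV // xB andbT; apply: q1V; rewrite inE eqxx.
rewrite -l1; apply: path_connect_in => // w' wq'.
by rewrite in_setD; have /= -> := q1V _ wq'; rewrite qS // -cat_cons mem_cat wq'.
Qed.

(* Otherwise the union of the two blocks and of a path avoiding [y] would be
   biconnected. *)
Lemma blocks_separated B C y x z : is_block e B -> is_block e C -> B != C ->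
  y \in B -> y \in C -> x \in B -> z \in C -> x != y ->
  ~~ connect (induced e ([set: T] :\ y)) x z.
Proof.
move=> /andP[biB /forallP maxB] /andP[biC /forallP maxC] BC yB yC xB zC xy.
apply/negP => /connectP[q0 pq0 lq0]; move: lq0; case/shortenP: pq0 => q pq uq _ lq.
have yq : y \notin x :: q.
  rewrite inE negb_or eq_sym xy; apply/negP => /(path_induced_mem pq).
  by rewrite !inE eqxx.
have {}pq : path e x q by apply: sub_path pq; apply: induced_e.
pose S := B :|: C :|: [set w in x :: q].
have BS : B \subset S by rewrite /S -setUA subsetUl.
have CS : C \subset S by rewrite /S (setUC B) -setUA subsetUl.
have [cB cC] : connected_in e B /\ connected_in e C.
  by case/and3P: biB => _ -> _; case/and3P: biC.
have : B \proper S.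
  rewrite properE BS; apply/negP => SB; have CB := subset_trans CS SB.
  have : C \proper B by rewrite properEneq CB andbT eq_sym.
  by have /implyP H := maxC B => /H; rewrite biB.
have /implyP H := maxB S => /H /negP; apply; apply/and3P; split.
- by apply: leq_trans (subset_leq_card BS); case/and3P: biB.
- rewrite -[S]setD0; apply: (@union_with_path_connected B C set0 x z y q) => //.
  + by rewrite setD0.
  + by rewrite setD0.
  + by move=> v v'; rewrite inE.
apply/forall_inP => v _; apply: (@union_with_path_connected B C [set v] x z y q) => //.
- exact: connected_in_D1.
- exact: connected_in_D1.
by move=> v1 v2; rewrite !inE => /eqP-> /eqP->.
Qed.

(** Let [C] be the block following [y] on the tree path and [R] the component, in the graph without
    [y], of the rest of [C]; [H] is the complement of [R]. The vertex [y] separates [B1] from [C],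
    and the path does not return to [y], so its later blocks stay in [R]. *)
Lemma cut_sides B1 B2 y (p : seq ({set T} + T)) :
  is_block e B1 -> y \in B1 ->
  path (btree_adj e) (inl B1) p -> uniq (inl B1 :: p) -> last (inl B1) p = inl B2 ->
  inr y \in p ->
  exists H : {set T}, [/\ y \in H, B1 \subset H, B2 \subset y |: ~: H,
    forall x z, e x z -> x \in H -> z \notin H -> x = y
  & forall w, w \in y |: ~: H -> connect (induced e (y |: ~: H)) y w].
Proof.
move=> blB1 yB1 pp up lp yp.
case/splitPr: yp pp up lp => p1 p2 pp up lp.
move: pp lp; rewrite cat_path last_cat /= => /and3P[_ _ pp] lp.
have B1p : inl B1 \notin p2.
  by move: up; rewrite /= mem_cat inE !negb_or => /andP[/and3P[_ _]].
have yp2 : inr y \notin p2.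
  by move: up; rewrite -cat_cons cat_uniq /= => /and3P[_ _ /andP[]].
case: p2 pp lp B1p yp2 {up} => [//|[C|//] p2] /= /andP[/and3P[blC _ yC] pp] lp.
rewrite inE negb_or => /andP[B1C _]; rewrite inE /= => yp2.
have {}B1C : B1 != C by [].
have biC : biconnected e C by case/andP: blC.
have [k0 k0C k0y] : exists2 k0, k0 \in C & k0 != y.
  have : 0 < #|C :\ y| by case/and3P: biC => + _ _; rewrite (cardsD1 y) yC.
  by case/card_gt0P=> k0; rewrite !inE => /andP[]; exists k0.
pose D := [set: T] :\ y.
pose R := [set x | connect (induced e D) k0 x].
have Rk0 : k0 \in R by rewrite inE connect0.
have Ry : y \notin R.
  rewrite inE; apply/negP => /connectP[q pq Ey]; case/lastP: q pq Ey => [_ /= E|q w pq].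
    by rewrite E eqxx in k0y.
  rewrite last_rcons => E; have := path_induced_mem pq (_ : w \in rcons q w).
  by rewrite mem_rcons inE eqxx -E !inE eqxx => /(_ isT).
have stepR x z : x \in R -> e x z -> z != y -> z \in R.
  move=> xR exz zy; have xy : x != y by apply: contraNneq Ry => <-.
  move: xR; rewrite !inE => /connect_trans; apply; apply: connect1.
  by rewrite inducedE !inE xy zy.
have blockR S x : biconnected e S -> x \in S -> x \in R -> S :\ y \subset R.
  move=> biS xS xR; have xy : x != y by apply: contraNneq Ry => <-.
  have SD : S :\ y \subset D by apply: setSD; apply: subsetT.
  apply/subsetP => w wS; move: xR; rewrite !inE => /connect_trans; apply.
  apply: connect_inducedS SD _; apply: connected_inP => //; first exact: connected_in_D1.
  by rewrite !inE xy.
(* Carried along the tree path beyond [y]: consecutive blocks share a cut vertex other than [y],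
   which keeps them in [R]. *)
pose inv (X : {set T} + T) := match X with inl B => B :\ y \subset R | inr v => v \in R end.
have inv_path X q : inv X -> path (btree_adj e) X q -> inr y \notin q -> inv (last X q).
  elim: q X => //= Y q IH X iX /andP[XY pq]; rewrite inE negb_or => /andP[Yy yq].
  apply: IH => //; case: X Y iX XY Yy {pq} => [S|v] [S'|v'] //=.
    move=> /subsetP SR /and3P[_ _ vS] vy; apply: SR; rewrite !inE vS andbT.
    by apply: contraNneq vy => ->.
  by move=> vR /and3P[/andP[biS _] _ vS] _; apply: blockR vS vR.
have B2R : B2 :\ y \subset R.
  have := inv_path (inl C) p2 (blockR _ _ biC k0C Rk0) pp yp2.
  by rewrite lp.
exists (~: R); rewrite setCK; split.
- by rewrite inE.
- apply/subsetP => w wB1; rewrite !inE; have [->|wy] := eqVneq w y.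
    by move: Ry; rewrite inE.
  by apply: (@blocks_separated C B1 y) => //; rewrite eq_sym.
- apply/subsetP => w wB2; rewrite in_setU1; case: eqVneq => //= wy.
  by apply: (subsetP B2R); rewrite !inE wy.
- move=> x z exz; rewrite !in_setC negbK => xR zR; apply/eqP; apply: contraT => xy.
  by rewrite e_sym in exz; rewrite (stepR _ _ zR exz xy) in xR.
move=> w; rewrite in_setU1 => /predU1P[->|wR]; first exact: connect0.
apply: (@connect_trans _ _ k0).
  apply: (@connect_inducedS C).
    apply/subsetP => x xC; rewrite in_setU1; case: eqVneq => //= xy.
    by apply: (subsetP (blockR _ _ biC k0C Rk0)); rewrite !inE xy.
  by apply: connected_inP => //; case/and3P: biC.
move: wR; rewrite inE => /connectP[q pq ->]; apply: path_connect_in.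
  by apply: sub_path pq; apply: induced_e.
move=> x; rewrite in_setU1 => xq; apply/orP; right.
case/splitPl: xq pq => q1 q2 <- pq; rewrite inE; apply/connectP; exists q1 => //.
by move: pq; rewrite cat_path => /andP[].
Qed.

End Separation.

(** * Assembly for one block, then for both *)

Section TwoBlocks.
Variables (K : fieldType) (T : finType) (e : rel T).
Hypotheses (e_sym : symmetric e) (e_irr : irreflexive e).

Lemma odd_cycles_of_block (B1 B2 : {set T}) y (p : seq ({set T} + T)) :
  graph_CI e K -> is_block e B1 -> is_block e B2 ->
  ~ bipartite_in e B1 -> ~ bipartite_in e B2 -> y \in B1 ->
  path (btree_adj e) (inl B1) p -> uniq (inl B1 :: p) -> last (inl B1) p = inl B2 ->
  inr y \in p ->
  [/\ forall C1 C2 C3 : {set T}, odd_chordless_cycle e C1 ->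
        odd_chordless_cycle e C2 -> odd_chordless_cycle e C3 ->
        C1 \subset B1 -> C2 \subset B1 -> C3 \subset B1 ->
        C1 = C2 \/ C1 = C3 \/ C2 = C3,
      exists C : {set T}, [/\ odd_chordless_cycle e C, C \subset B1, y \in C &
        forall C', odd_chordless_cycle e C' -> C' \subset B1 -> y \in C' -> C' = C]
    & forall C, odd_chordless_cycle e C -> C \subset B1 -> y \notin C ->
        exists2 z, z \in C & e y z].
Proof.
move=> /(graph_markov_basis e_irr)[k [u [u_in u_dg u_free u_span]]] bl1 bl2 nb1 nb2 yB1 pp up lp yp.
have [H [yH B1H B2H Hside Hconn]] := cut_sides e_sym bl1 yB1 pp up lp yp.
have bi1 : biconnected e B1 by case/andP: bl1.
have cB1 : connected_in e B1 by case/and3P: bi1.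
have cB2 : connected_in e B2 by case/andP: bl2 => /and3P[].
have [s [ws cs _]] := odd_chordless_in e_sym e_irr cB1 nb1.
have [us s2] : uniq s /\ 2 < size s by case/and4P: cs.
have [s0 ws0 ys0] : exists2 w, oddwalk e B1 (y :: w) & y \notin w.
  have [v vy] : exists v, v != y.
    case: s us s2 {ws cs} => [|x [|x' s]] //=; rewrite inE negb_or => /andP[/andP[xx' _] _] _.
    by have [E|] := eqVneq x y; [exists x'; rewrite -E eq_sym|exists x].
  by have [w [ww yw _]] := odd_walk_avoiding e_sym bi1 yB1 ws us (ltnW s2) vy; exists w.
(* An odd walk of [B2] may miss [y]; it is then joined to [y] by a path on its own side. *)
have [t wt yt] : exists2 t, oddwalk e (y |: ~: H) (y :: t) & y \notin t.
  have [s2' ws2] := nonbipartite_oddwalk e_sym cB2 nb2.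
  have {}ws2 := oddwalkS B2H ws2.
  case: s2' ws2 => // w c wc.
  suff [t wt] : exists t, oddwalk e (y |: ~: H) (y :: t) by apply: oddwalk_simple wt.
  have /connectP[q pq lq] : connect (induced e (y |: ~: H)) y w.
    by apply: Hconn; apply: (oddwalk_subset wc); rewrite inE eqxx.
  case/lastP: q pq lq => [_ /= E|q w' pq]; first by exists c; move: wc; rewrite E.
  rewrite last_rcons => E; subst w'; exists (rcons q w ++ rcons c w ++ rev q).
  exact: oddwalk_attach.
have [a [b [ain bin [ay by0] ab amin]]] := minimal_straddle e_sym e_irr u_in u_dg u_free u_span
  yH Hside (oddwalkS B1H ws0) ys0 wt yt.
have amin1 s1 : oddwalk e B1 (y :: s1) -> y \notin s1 ->
    forall v, v != y -> ldg a v <= count_mem v s1.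
  by move=> w1; apply: amin; apply: oddwalkS w1.
have sub1 (r : seq T) : [set x in r] \subset B1 -> {subset r <= B1}.
  by move=> /subsetP sub x xr; apply: sub; rewrite inE.
have through C C' : odd_chordless_cycle e C -> odd_chordless_cycle e C' ->
    C \subset B1 -> C' \subset B1 -> y \in C -> y \in C' -> C = C'.
  move=> [r [cr or ->]] [r' [cr' or' ->]] /sub1 rB /sub1 rB'; rewrite !inE => yr yr'.
  apply/setP => v; rewrite !inE.
  have supp := odd_chordless_through_support e_sym yB1 bi1 ain bin ay by0 ab amin1.
  by rewrite (supp r) // (supp r').
have avoid C C' : odd_chordless_cycle e C -> odd_chordless_cycle e C' ->
    C \subset B1 -> C' \subset B1 -> y \notin C -> y \notin C' -> C = C'.
  move=> [r [cr or ->]] [r' [cr' or' ->]] /sub1 rB /sub1 rB'; rewrite !inE => yr yr'.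
  have incl := avoiding_cycles_subset e_sym e_irr u_in u_dg u_free u_span yB1 bi1
    ain bin ay by0 ab amin1.
  by apply/setP => v; rewrite !inE; apply/idP/idP; [apply: (incl r r') | apply: (incl r' r)].
split.
- move=> C1 C2 C3 o1 o2 o3 b1 b2 b3.
  (* Two of the three cycles agree on whether they contain [y]. *)
  have [y1|y1] := boolP (y \in C1); have [y2|y2] := boolP (y \in C2);
  have [y3|y3] := boolP (y \in C3);
  by [left; apply: through | left; apply: avoid | right; left; apply: through
     | right; left; apply: avoid | right; right; apply: through | right; right; apply: avoid].
- have [r yr [cr or rB]] := odd_chordless_through e_sym e_irr yB1 bi1 ain ay amin1 nb1.
  have oC : odd_chordless_cycle e [set x in r] by exists r.
  have CB : [set x in r] \subset B1 by apply/subsetP => x; rewrite inE => /rB.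
  have yC : y \in [set x in r] by rewrite inE.
  by exists [set x in r]; split=> // C' oC' CB' yC'; apply: through.
move=> C [r [cr or ->]] /sub1 rB; rewrite inE => yr.
have [z [_ [_ eyz _ az _]]] := straddle_neighbours e_sym e_irr yB1 bi1 ain ay amin1 cr or rB.
exists z => //; rewrite inE.
have zy : z != y by apply: contraTneq eyz => ->; rewrite e_irr.
by have := leq_trans az (straddle_support e_sym yB1 bi1 amin1 cr or rB zy); case: (z \in r).
Qed.

End TwoBlocks.

Theorem theorem6p4 (K : fieldType) (T : finType) (e : rel T)
  (e_sym : symmetric e) (e_irr : irreflexive e)
  (G_conn : gconnected e)
  (G_CI : graph_CI e K)
  (B1 B2 : {set T})
  (B1_block : is_block e B1) (B2_block : is_block e B2) (B12 : B1 != B2)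
  (B1_nb : ~ bipartite_in e B1) (B2_nb : ~ bipartite_in e B2)
  (only_two : forall B, is_block e B -> ~ bipartite_in e B -> B = B1 \/ B = B2)
  (y12 y21 : T)
  (p : seq ({set T} + T))
  (p_path : path (btree_adj e) (inl B1) p)
  (p_uniq : uniq (inl B1 :: p))
  (p_end : last (inl B1) p = inl B2)
  (y12_cut : is_cut e y12) (y12_B1 : y12 \in B1) (y12_p : inr y12 \in p)
  (y21_cut : is_cut e y21) (y21_B2 : y21 \in B2) (y21_p : inr y21 \in p) :
  (* at most two odd chordless cycles in each of B1, B2 *)
  (forall C1 C2 C3 : {set T},
     odd_chordless_cycle e C1 -> odd_chordless_cycle e C2 -> odd_chordless_cycle e C3 ->
     C1 \subset B1 -> C2 \subset B1 -> C3 \subset B1 ->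
     C1 = C2 \/ C1 = C3 \/ C2 = C3) /\
  (forall C1 C2 C3 : {set T},
     odd_chordless_cycle e C1 -> odd_chordless_cycle e C2 -> odd_chordless_cycle e C3 ->
     C1 \subset B2 -> C2 \subset B2 -> C3 \subset B2 ->
     C1 = C2 \/ C1 = C3 \/ C2 = C3) /\
  (* exactly one odd chordless cycle of B1 through y12, of B2 through y21 *)
  (exists C : {set T}, [/\ odd_chordless_cycle e C, C \subset B1, y12 \in C &
     forall C', odd_chordless_cycle e C' -> C' \subset B1 -> y12 \in C' -> C' = C]) /\
  (exists C : {set T}, [/\ odd_chordless_cycle e C, C \subset B2, y21 \in C &
     forall C', odd_chordless_cycle e C' -> C' \subset B2 -> y21 \in C' -> C' = C]) /\
  (* any other odd chordless cycle has distance one from the cut vertex *)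
  (forall C, odd_chordless_cycle e C -> C \subset B1 -> y12 \notin C ->
     exists2 z, z \in C & e y12 z) /\
  (forall C, odd_chordless_cycle e C -> C \subset B2 -> y21 \notin C ->
     exists2 z, z \in C & e y21 z).
Proof.
have [two1 one1 dist1] := odd_cycles_of_block e_sym e_irr G_CI B1_block B2_block
  B1_nb B2_nb y12_B1 p_path p_uniq p_end y12_p.
(* The case of [B2] is that of [B1] for the reversed tree path. *)
pose q := rev (belast (inl B1 : {set T} + T) p).
have qE : rev (inl B1 :: p) = inl B2 :: q by rewrite lastI rev_rcons p_end.
have q_path : path (btree_adj e) (inl B2) q.
  rewrite -p_end rev_path; apply: sub_path p_path.
  by move=> [S|v] [S'|v'].
have q_uniq : uniq (inl B2 :: q) by rewrite -qE rev_uniq.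
have q_end : last (inl B2) q = inl B1.
  by rewrite -[LHS]/(last (inl B2) (inl B2 :: q)) -qE rev_cons last_rcons.
have y21_q : inr y21 \in q.
  have : inr y21 \in inl B2 :: q by rewrite -qE mem_rev inE y21_p orbT.
  by rewrite inE.
have [two2 one2 dist2] := odd_cycles_of_block e_sym e_irr G_CI B2_block B1_block
  B2_nb B1_nb y21_B2 q_path q_uniq q_end y21_q.
by [].
Qed.
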